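(* Let $(t_n)$ be a sequence of integers $t_n\ge 2$ with $t_n=o(\log\log n)$ as $n\to\infty$, and let $(S_n)$ be a sequence of positive integers such that, for all sufficiently large $n$, $S_n\ge N_n$ and $S_n$ is $t_n$-free. Then for all sufficiently large $n$, $\sigma(S_n)<e^\gamma S_n\log\log S_n$.
   Context: An integer $m$ is $t$-free iff $p^t\nmid m$ for every prime $p$. $\sigma$ is the sum-of-divisors function and $\gamma$ the Euler–Mascheroni constant. $p_k$ denotes the $k$-th prime and $N_k=\prod_{i=1}^k p_i$ the $k$-th primorial number. *)

(* Defs.v *)
From Stdlib Require Import Reals Lra Lia Arith List ClassicalEpsilon.
Import ListNotations.
Open Scope R_scope.

Definition is_prime (p : nat) : Prop :=
  (2 <= p)%nat /\ forall d : nat, Nat.divide d p -> d = 1%nat \/ d = p.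

(** The smallest prime strictly greater than [p] (chosen by Hilbert epsilon;
    such a prime exists by Euclid). *)
Definition next_prime (p : nat) : nat :=
  epsilon (inhabits 0%nat)
    (fun q => is_prime q /\ (p < q)%nat /\
              forall r, (p < r < q)%nat -> ~ is_prime r).

(** [prime_seq i] is the (i+1)-th prime: prime_seq 0 = 2, prime_seq 1 = 3, ... *)
Fixpoint prime_seq (i : nat) : nat :=
  match i with
  | O => 2
  | S i' => next_prime (prime_seq i')
  end.

(** p_k, the k-th prime (k >= 1). *)
Definition pk (k : nat) : nat := prime_seq (k - 1).

Fixpoint primorial (k : nat) : nat :=
  match k with
  | O => 1
  | S k' => (primorial k' * prime_seq k')%nat
  end.

Definition sigma_div (m : nat) : nat :=
  list_sum (filter (fun d => Nat.eqb (m mod d) 0) (seq 1 m)).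

Definition t_free (t m : nat) : Prop :=
  forall p, is_prime p -> ~ Nat.divide (p ^ t) m.

Definition euler_gamma : R :=
  epsilon (inhabits 0)
    (fun g => Un_cv (fun n => sum_f_R0 (fun k => / INR (S k)) n - ln (INR (S n))) g).

(* Main.v *)
Require Import Defs.
From Stdlib Require Import Reals Lra Lia Arith List ClassicalEpsilon.
Open Scope R_scope.

(** For a [t]-free [s], [sigma s / s] is at most the product of
    [(1 - p^-t) / (1 - 1/p)] over the primes [p] dividing [s].  With [X = floor (ln s)],
    the primes [p > X] dividing [s] are fewer than [ln s / ln X], so they only cost a factor
    [exp (O (1 / ln X))], and the others cost at most
    [(1 - 2^-t) * prod_{p <= X} (1 - 1/p)^-1].  Mertens' third theorem in the form
    [prod_{p <= X} (1 - 1/p)^-1 <= e^gamma * ln X * exp (10 / ln X)] then reduces the claim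
    to [2^t = o (ln X)], which is what [t_n = o (ln (ln n))] gives, since
    [ln s >= ln N_n >= n ln 2].

    For Mertens' theorem, let [L x = - sum_{p <= x} ln (1 - 1/p)].  Partial summation from
    [sum_{p <= x} ln p / p = ln x + O(1)] shows that [L - ln ln] can decrease
    after [x] by at most [10 / ln x]; so if the bound failed at some [x], then
    [L y >= ln (ln y) + gamma + k] for all [y >= x] and some [k > 0].  Comparing [L (2^m)]
    with the harmonic numbers [H_m] under the Abel weights [2^(-d m)], this contradicts
    [sum_p - ln (1 - p^-(1+d)) <= ln (1 + 1/d)] as [d] tends to [0]. *)

(** * Finite sums over the integers from 1 to [N] *)

Fixpoint nsum (f : nat -> R) (N : nat) : R :=
  match N with
  | O => 0
  | S k => nsum f k + f (S k)
  end.

Lemma nsum_ext f g N :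
  (forall n, (1 <= n <= N)%nat -> f n = g n) -> nsum f N = nsum g N.
Proof.
  induction N as [|N IH]; intros H; simpl; [easy|].
  rewrite IH, (H (S N)); auto with arith. intros; apply H; lia.
Qed.

Lemma nsum_le f g N :
  (forall n, (1 <= n <= N)%nat -> f n <= g n) -> nsum f N <= nsum g N.
Proof.
  induction N as [|N IH]; intros H; simpl; [lra|].
  apply Rplus_le_compat; [apply IH; intros; apply H|apply H]; lia.
Qed.

Lemma nsum_plus f g N : nsum (fun n => f n + g n) N = nsum f N + nsum g N.
Proof. induction N as [|N IH]; simpl; [|rewrite IH]; ring. Qed.

Lemma nsum_scal c f N : nsum (fun n => c * f n) N = c * nsum f N.
Proof. induction N as [|N IH]; simpl; [|rewrite IH]; ring. Qed.

Lemma nsum_zero N : nsum (fun _ => 0) N = 0.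
Proof. induction N as [|N IH]; simpl; [|rewrite IH]; ring. Qed.

Lemma nsum_ge0 f N : (forall n, (1 <= n <= N)%nat -> 0 <= f n) -> 0 <= nsum f N.
Proof. intros H. rewrite <- (nsum_zero N). now apply nsum_le. Qed.

Lemma nsum_exchange (f : nat -> nat -> R) M N :
  nsum (fun i => nsum (f i) M) N = nsum (fun j => nsum (fun i => f i j) N) M.
Proof.
  induction N as [|N IH]; simpl; [now rewrite nsum_zero|].
  now rewrite IH, nsum_plus.
Qed.

Lemma nsum_le_bound f M N :
  (forall n, (M < n <= N)%nat -> 0 <= f n) -> (M <= N)%nat -> nsum f M <= nsum f N.
Proof.
  intros Hf HMN. induction HMN as [|N HMN IH]; [lra|].
  simpl. assert (nsum f M <= nsum f N) by (apply IH; intros; apply Hf; lia).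
  assert (0 <= f (S N)) by (apply Hf; lia). lra.
Qed.

Lemma nsum_truncate f M N :
  (M <= N)%nat -> nsum (fun n => if (n <=? M)%nat then f n else 0) N = nsum f M.
Proof.
  intros H. induction H as [|N H IH].
  - apply nsum_ext. intros n Hn. now rewrite (proj2 (Nat.leb_le n M)) by lia.
  - cbn [nsum]. rewrite IH, (proj2 (Nat.leb_gt (S N) M)) by lia. ring.
Qed.

Lemma nsum_delta f q N :
  (1 <= q <= N)%nat -> nsum (fun n => if (n =? q)%nat then f n else 0) N = f q.
Proof.
  intros Hq. induction N as [|N IH]; [lia|]. cbn [nsum].
  destruct (Nat.eq_dec q (S N)) as [->|Hne].
  - rewrite (nsum_ext _ (fun _ => 0)), nsum_zero, Nat.eqb_refl; [ring|].
    intros n Hn. now rewrite (proj2 (Nat.eqb_neq n (S N))) by lia.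
  - rewrite IH by lia. rewrite (proj2 (Nat.eqb_neq (S N) q)) by lia. ring.
Qed.

(** * Divisibility and primes *)

Definition dvdb (d n : nat) : bool := (n mod d =? 0)%nat.

Lemma dvdb_true d n : dvdb d n = true <-> Nat.divide d n.
Proof. unfold dvdb. rewrite Nat.eqb_eq. apply Nat.Lcm0.mod_divide. Qed.

Lemma dvdb_false d n : dvdb d n = false <-> ~ Nat.divide d n.
Proof. rewrite <- dvdb_true. destruct (dvdb d n); split; congruence. Qed.

Lemma nsum_multiples f p N :
  (1 <= p)%nat ->
  nsum (fun n => if dvdb p n then f n else 0) N = nsum (fun m => f (p * m)%nat) (N / p).
Proof.
  intros Hp. induction N as [|N IH]; [now rewrite Nat.Div0.div_0_l|].
  cbn [nsum]. rewrite IH. destruct (dvdb p (S N)) eqn:E.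
  - apply dvdb_true in E as [m Hm].
    assert (1 <= m)%nat by (destruct m; lia).
    assert (E1 : (S N / p = S (m - 1))%nat).
    { rewrite Hm, Nat.div_mul; lia. }
    assert (E2 : (N / p = m - 1)%nat).
    { symmetry. apply Nat.div_unique with (r := (p - 1)%nat); nia. }
    rewrite E1, E2. cbn [nsum]. do 2 f_equal. nia.
  - apply dvdb_false in E.
    replace (S N / p)%nat with (N / p)%nat; [ring|].
    pose proof (Nat.div_mod N p ltac:(lia)) as H1.
    pose proof (Nat.mod_upper_bound N p ltac:(lia)) as H2.
    apply Nat.div_unique with (r := S (N mod p)); [|lia].
    assert (S (N mod p) <> p); [|lia].
    intros H3. apply E. exists (S (N / p)). nia.
Qed.

Lemma is_prime_ge2 p : is_prime p -> (2 <= p)%nat.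
Proof. now intros []. Qed.

Lemma prime_divides_mul p a b :
  is_prime p -> Nat.divide p (a * b) -> Nat.divide p a \/ Nat.divide p b.
Proof.
  intros [H2 Hp] H.
  destruct (Hp (Nat.gcd p a) (Nat.gcd_divide_l p a)) as [E|E].
  - right. now apply Nat.gauss with a.
  - left. rewrite <- E. apply Nat.gcd_divide_r.
Qed.

Lemma prime_divides_prime p q : is_prime p -> is_prime q -> Nat.divide p q -> p = q.
Proof. intros [Hp _] [_ Hq] H. destruct (Hq _ H); lia. Qed.

Lemma exists_prime_divisor n :
  (2 <= n)%nat -> exists p, is_prime p /\ Nat.divide p n.
Proof.
  induction n as [n IH] using lt_wf_ind. intros Hn.
  destruct (classic (is_prime n)) as [Hp|Hp].
  - exists n. split; [easy|apply Nat.divide_refl].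
  - assert (exists d, Nat.divide d n /\ d <> 1%nat /\ d <> n) as [d [Hd [H1 H2]]].
    { apply NNPP. intros H. apply Hp. split; [easy|]. intros d Hd.
      apply NNPP. intros H'. apply H. exists d. tauto. }
    assert (d <= n)%nat by (apply Nat.divide_pos_le; [lia|easy]).
    assert (d <> 0)%nat by (intros ->; apply Nat.divide_0_l in Hd; lia).
    destruct (IH d) as [p [Hp1 Hp2]]; [lia|lia|].
    exists p. split; [easy|]. now apply Nat.divide_trans with d.
Qed.

(** Primality is decided classically, so that sums over primes become ordinary sums with a boolean
    test. *)
Definition primeb (n : nat) : bool :=
  if excluded_middle_informative (is_prime n) then true else false.

Lemma primeb_true n : primeb n = true <-> is_prime n.
Proof.
  unfold primeb. destruct (excluded_middle_informative (is_prime n)); split; congruence.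
Qed.

(** * Sums over the primes up to [N] *)

Definition psum (f : nat -> R) (N : nat) : R :=
  nsum (fun n => if primeb n then f n else 0) N.

Lemma psum_le f g N :
  (forall p, is_prime p -> (p <= N)%nat -> f p <= g p) -> psum f N <= psum g N.
Proof.
  intros H. apply nsum_le. intros n Hn. destruct (primeb n) eqn:E; [|lra].
  apply primeb_true in E. apply H; [easy|lia].
Qed.

Lemma psum_ext f g N :
  (forall p, is_prime p -> (p <= N)%nat -> f p = g p) -> psum f N = psum g N.
Proof.
  intros H. apply Rle_antisym; apply psum_le; intros; rewrite H; auto; lra.
Qed.

Lemma psum_plus f g N : psum (fun n => f n + g n) N = psum f N + psum g N.
Proof.
  unfold psum. rewrite <- nsum_plus. apply nsum_ext. intros n _.
  destruct (primeb n); ring.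
Qed.

Lemma psum_scal c f N : psum (fun n => c * f n) N = c * psum f N.
Proof.
  unfold psum. rewrite <- nsum_scal. apply nsum_ext. intros n _.
  destruct (primeb n); ring.
Qed.

Lemma psum_le_nsum f N :
  (forall n, (1 <= n <= N)%nat -> 0 <= f n) -> psum f N <= nsum f N.
Proof.
  intros H. apply nsum_le. intros n Hn. destruct (primeb n); [lra|now apply H].
Qed.

Lemma psum_le_bound f M N :
  (forall p, is_prime p -> (M < p <= N)%nat -> 0 <= f p) -> (M <= N)%nat ->
  psum f M <= psum f N.
Proof.
  intros H. apply nsum_le_bound. intros n Hn. destruct (primeb n) eqn:E; [|lra].
  apply H; [now apply primeb_true|easy].
Qed.

Lemma psum_truncate f M N :
  (M <= N)%nat -> psum (fun n => if (n <=? M)%nat then f n else 0) N = psum f M.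
Proof.
  intros H. unfold psum. rewrite <- (nsum_truncate _ M N H). apply nsum_ext.
  intros n _. destruct (primeb n), (n <=? M)%nat; easy.
Qed.

Lemma psum_delta f q N :
  is_prime q -> (q <= N)%nat -> psum (fun n => if (n =? q)%nat then f n else 0) N = f q.
Proof.
  intros Hq H. assert (2 <= q)%nat by now apply is_prime_ge2.
  unfold psum. rewrite <- (nsum_delta f q N) by lia. apply nsum_ext. intros n _.
  destruct (Nat.eqb_spec n q) as [->|]; [|now destruct (primeb n)].
  now rewrite (proj2 (primeb_true q)).
Qed.

Lemma psum_step f n :
  psum f (S n) = psum f n + (if primeb (S n) then f (S n) else 0).
Proof. easy. Qed.

(** * Valuations *)

(** Exponent of [p] in [n]. For [p >= 2] each division lowers a positive argument, so [n] units of
    fuel suffice when [n >= 1]. *)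
Fixpoint val_fuel (fuel p n : nat) : nat :=
  match fuel with
  | O => O
  | S k => if dvdb p n then S (val_fuel k p (n / p)) else O
  end.

Definition val (p n : nat) : nat := val_fuel n p n.

Lemma val_fuel_enough p k : forall n, (2 <= p)%nat -> (1 <= n <= k)%nat ->
  val_fuel k p n = val p n.
Proof.
  assert (H : forall k k' n, (2 <= p)%nat -> (1 <= n <= k)%nat -> (n <= k')%nat ->
            val_fuel k p n = val_fuel k' p n).
  { clear k. induction k as [|k IH]; intros [|k'] n Hp Hn Hk; try lia. simpl.
    destruct (dvdb p n) eqn:E; [|easy]. f_equal.
    apply dvdb_true in E as [m ->]. rewrite Nat.div_mul by lia.
    apply IH; nia. }
  intros. apply H; lia.
Qed.

Lemma val_mul_self p m : (2 <= p)%nat -> (1 <= m)%nat -> val p (p * m) = S (val p m).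
Proof.
  intros Hp Hm. unfold val at 1.
  replace (p * m)%nat with (S (p * m - 1)) at 1 by nia. cbn [val_fuel].
  rewrite (proj2 (dvdb_true p (p * m))) by (exists m; lia).
  rewrite (Nat.mul_comm p m), Nat.div_mul by lia.
  rewrite val_fuel_enough; nia.
Qed.

Lemma val_not_divide p n : ~ Nat.divide p n -> val p n = O.
Proof.
  intros H. apply dvdb_false in H. unfold val. destruct n; [easy|].
  simpl. now rewrite H.
Qed.

(** Factors [p] are stripped from [m] one at a time; once none is left, Euclid's lemma keeps [p]
    from dividing [q * m]. *)
Lemma val_mul_other_prime p q m :
  is_prime p -> is_prime q -> p <> q -> (1 <= m)%nat -> val p (q * m) = val p m.
Proof.
  intros Hp Hq Hpq. pose proof (is_prime_ge2 p Hp). pose proof (is_prime_ge2 q Hq).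
  induction m as [m IH] using lt_wf_ind. intros Hm.
  destruct (classic (Nat.divide p m)) as [[k ->]|Hd].
  - replace (q * (k * p))%nat with (p * (q * k))%nat by ring.
    rewrite (Nat.mul_comm k p), !val_mul_self by nia. f_equal. apply IH; nia.
  - rewrite !val_not_divide; [easy|easy|].
    intros [H'|H']%prime_divides_mul; [|easy|easy].
    now apply Hpq, prime_divides_prime.
Qed.

(** Removing a prime divisor [q] lowers the logarithm by [ln q] and only the valuation at [q], by
    one. The range [N] does not depend on [n], so that the formulas for all [n <= N] can be added
    up. *)
Lemma ln_prime_factorization N n :
  (1 <= n <= N)%nat -> ln (INR n) = psum (fun p => INR (val p n) * ln (INR p)) N.
Proof.
  induction n as [n IH] using lt_wf_ind. intros Hn.
  destruct (Nat.eq_dec n 1) as [->|Hn1].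
  - rewrite (psum_ext _ (fun p => 0 * 0)).
    + rewrite psum_scal. simpl. rewrite ln_1. ring.
    + intros p Hp _. rewrite val_not_divide; [simpl; ring|].
      intros H%Nat.divide_1_r. apply is_prime_ge2 in Hp. lia.
  - destruct (exists_prime_divisor n ltac:(lia)) as [q [Hq [m ->]]].
    pose proof (is_prime_ge2 q Hq). assert (1 <= m)%nat by nia.
    rewrite mult_INR, ln_mult by (apply lt_0_INR; lia).
    rewrite (IH m) by nia.
    replace (ln (INR q)) with (psum (fun p => if (p =? q)%nat then ln (INR p) else 0) N)
      by (apply (psum_delta (fun p => ln (INR p))); [easy|nia]).
    rewrite <- psum_plus. apply psum_ext. intros p Hp _.
    destruct (Nat.eqb_spec p q) as [->|Hpq].
    + rewrite (Nat.mul_comm m q), val_mul_self, S_INR by lia. ring.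
    + rewrite (Nat.mul_comm m q), (val_mul_other_prime p q m) by easy. ring.
Qed.

(** * Inequalities for the real logarithm and a weak Stirling formula *)

Lemma INR_ge1 n : (1 <= n)%nat -> 1 <= INR n.
Proof. intros H. apply le_INR in H. simpl in H. lra. Qed.

Lemma INR_ge2 n : (2 <= n)%nat -> 2 <= INR n.
Proof. intros H. apply le_INR in H. simpl in H. lra. Qed.

Lemma prime_INR_ge2 p : is_prime p -> 2 <= INR p.
Proof. intros H. now apply INR_ge2, is_prime_ge2. Qed.

Lemma ln_le x y : 0 < x -> x <= y -> ln x <= ln y.
Proof.
  intros Hx [H| ->]; [left; now apply ln_increasing|lra].
Qed.

Lemma exp_le x y : x <= y -> exp x <= exp y.
Proof. intros [H| ->]; [left; now apply exp_increasing|lra]. Qed.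

Lemma ln_le_sub1 x : 0 < x -> ln x <= x - 1.
Proof.
  intros Hx. destruct (Req_dec x 1) as [->|H]; [rewrite ln_1; lra|].
  rewrite <- (ln_exp (x - 1)). apply ln_le; [easy|].
  pose proof (exp_ineq1_le (x - 1)). lra.
Qed.

Lemma ln_div x y : 0 < x -> 0 < y -> ln (x / y) = ln x - ln y.
Proof.
  intros Hx Hy. unfold Rdiv.
  rewrite ln_mult, ln_Rinv; [ring|easy|easy|now apply Rinv_0_lt_compat].
Qed.

Lemma ln_diff_le x y : 0 < x -> 0 < y -> ln y - ln x <= (y - x) / x.
Proof.
  intros Hx Hy. rewrite <- ln_div by easy.
  replace ((y - x) / x) with (y / x - 1) by (field; lra).
  apply ln_le_sub1. now apply Rdiv_lt_0_compat.
Qed.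

Lemma ln_ge0 x : 1 <= x -> 0 <= ln x.
Proof. intros H. rewrite <- ln_1. apply ln_le; lra. Qed.

Lemma ln_gt0 x : 1 < x -> 0 < ln x.
Proof. intros H. rewrite <- ln_1. apply ln_increasing; lra. Qed.

Lemma ln_S_sub n : (1 <= n)%nat ->
  / INR (S n) <= ln (INR (S n)) - ln (INR n) <= / INR n.
Proof.
  intros Hn. pose proof (INR_ge1 n Hn). rewrite S_INR. split.
  - pose proof (ln_diff_le (INR n + 1) (INR n) ltac:(lra) ltac:(lra)).
    replace ((INR n - (INR n + 1)) / (INR n + 1)) with (- / (INR n + 1)) in H0
      by (field; lra). lra.
  - pose proof (ln_diff_le (INR n) (INR n + 1) ltac:(lra) ltac:(lra)).
    replace ((INR n + 1 - INR n) / INR n) with (/ INR n) in H0 by (field; lra). lra.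
Qed.

Definition ln_fact (N : nat) : R := nsum (fun n => ln (INR n)) N.

Lemma ln_fact_bounds N : (1 <= N)%nat ->
  INR N * ln (INR N) - INR N <= ln_fact N
    <= INR N * ln (INR N) - INR N + ln (INR N) + 1.
Proof.
  induction 1 as [|N HN IH].
  - unfold ln_fact; simpl. rewrite ln_1. lra.
  - unfold ln_fact in *. cbn [nsum]. pose proof (ln_S_sub N HN) as [H1 H2].
    pose proof (INR_ge1 N HN).
    set (a := ln (INR N)) in *. set (b := ln (INR (S N))) in *.
    rewrite S_INR in *.
    (* The upper bound needs [(N + 1) * (b - a) >= 1] and the lower one [N * (b - a) <= 1]. *)
    apply (Rmult_le_compat_l (INR N + 1)) in H1; [|lra].
    apply (Rmult_le_compat_l (INR N)) in H2; [|lra].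
    rewrite Rinv_r in H1, H2 by lra. lra.
Qed.

Lemma ln_fact_le N : (1 <= N)%nat -> ln_fact N <= INR N * ln (INR N).
Proof.
  induction 1 as [|N HN IH].
  - unfold ln_fact; simpl. rewrite ln_1. lra.
  - unfold ln_fact in *. cbn [nsum].
    assert (ln (INR N) <= ln (INR (S N))).
    { apply ln_le; [apply lt_0_INR; lia|apply le_INR; lia]. }
    pose proof (INR_ge1 N HN). rewrite (S_INR N) at 2. nra.
Qed.

(** * Legendre's formula and Chebyshev's bound *)

(** The exponent of [p] in [N!]. *)
Definition val_fact (p N : nat) : R := nsum (fun n => INR (val p n)) N.

Lemma ln_fact_factorization N :
  ln_fact N = psum (fun p => val_fact p N * ln (INR p)) N.
Proof.
  unfold ln_fact.
  rewrite (nsum_ext _ (fun n => psum (fun p => INR (val p n) * ln (INR p)) N))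
    by (intros; now apply ln_prime_factorization).
  unfold psum. rewrite nsum_exchange. apply nsum_ext. intros p _.
  unfold val_fact. destruct (primeb p); [|apply nsum_zero].
  rewrite Rmult_comm, <- nsum_scal. apply nsum_ext. intros; ring.
Qed.

(** Legendre's formula in recursive form: only the multiples [p * m] with [m <= N / p] contribute,
    each [1 + val p m]. *)
Lemma val_fact_rec p N :
  (2 <= p)%nat -> val_fact p N = INR (N / p) + val_fact p (N / p).
Proof.
  intros Hp. unfold val_fact at 1.
  rewrite (nsum_ext _ (fun n => if dvdb p n then INR (val p n) else 0)).
  2:{ intros n _. destruct (dvdb p n) eqn:E; [easy|].
      apply dvdb_false in E. now rewrite val_not_divide. }
  rewrite nsum_multiples by lia.
  rewrite (nsum_ext _ (fun n => 1 + INR (val p n))).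
  2:{ intros n Hn. rewrite val_mul_self, S_INR by lia. ring. }
  rewrite nsum_plus. f_equal.
  generalize (N / p)%nat. induction n as [|n IH]; [easy|].
  rewrite S_INR. simpl. now rewrite IH.
Qed.

Lemma val_fact_ge0 p N : 0 <= val_fact p N.
Proof. apply nsum_ge0. intros. apply pos_INR. Qed.

Lemma INR_div_le N p : (1 <= p)%nat -> INR (N / p) * INR p <= INR N.
Proof.
  intros Hp. rewrite <- mult_INR. apply le_INR.
  rewrite Nat.mul_comm. apply Nat.Div0.mul_div_le.
Qed.

Lemma INR_div_gt N p : (1 <= p)%nat -> INR N <= (INR (N / p) + 1) * INR p.
Proof.
  intros Hp. rewrite <- S_INR, <- mult_INR. apply le_INR.
  pose proof (Nat.mul_succ_div_gt N p ltac:(lia)). lia.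
Qed.

Lemma val_fact_ge p N : (2 <= p)%nat -> INR N / INR p - 1 <= val_fact p N.
Proof.
  intros Hp. rewrite val_fact_rec by easy. pose proof (val_fact_ge0 p (N / p)).
  pose proof (INR_div_gt N p ltac:(lia)) as H1. pose proof (INR_ge2 p Hp).
  apply (Rmult_le_compat_r (/ INR p)) in H1; [|left; apply Rinv_0_lt_compat; lra].
  rewrite Rmult_assoc, Rinv_r in H1 by lra. unfold Rdiv. lra.
Qed.

(** The recursion sums a geometric series: [k + k / (p - 1) = k * p / (p - 1)] with [k = N / p]
    rounded down, and [k * p <= N]. *)
Lemma val_fact_le p N : (2 <= p)%nat -> val_fact p N <= INR N / (INR p - 1).
Proof.
  intros Hp. pose proof (INR_ge2 p Hp).
  induction N as [N IH] using lt_wf_ind.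
  destruct (Nat.eq_dec N 0) as [->|HN].
  - unfold val_fact; simpl. unfold Rdiv. lra.
  - rewrite val_fact_rec by easy.
    pose proof (IH (N / p)%nat ltac:(apply Nat.div_lt; lia)) as H1.
    pose proof (INR_div_le N p ltac:(lia)) as H2.
    apply Rle_trans with (INR (N / p) * INR p / (INR p - 1)).
    + replace (INR (N / p) * INR p / (INR p - 1))
        with (INR (N / p) + INR (N / p) / (INR p - 1)) by (field; lra). lra.
    + apply Rmult_le_compat_r; [|easy]. left. apply Rinv_0_lt_compat. lra.
Qed.

Lemma val_fact_mono p M N : (M <= N)%nat -> val_fact p M <= val_fact p N.
Proof. apply nsum_le_bound. intros. apply pos_INR. Qed.

Lemma val_fact_double p M : (2 <= p)%nat -> 2 * val_fact p M <= val_fact p (2 * M).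
Proof.
  intros Hp. induction M as [M IH] using lt_wf_ind.
  destruct (Nat.eq_dec M 0) as [->|HM]; [unfold val_fact; simpl; lra|].
  rewrite (val_fact_rec p M), (val_fact_rec p (2 * M)) by easy.
  pose proof (IH (M / p)%nat ltac:(apply Nat.div_lt; lia)) as H1.
  assert (H2 : (2 * (M / p) <= 2 * M / p)%nat).
  { apply Nat.div_le_lower_bound; [lia|].
    pose proof (Nat.Div0.mul_div_le M p). lia. }
  pose proof (val_fact_mono p _ _ H2). apply le_INR in H2.
  rewrite mult_INR in H2. simpl (INR 2) in H2. lra.
Qed.

Definition theta (N : nat) : R := psum (fun p => ln (INR p)) N.

(* Each prime in (M, 2M] divides (2M)! / (M!)^2. *)
Lemma theta_double M : theta (2 * M) - theta M <= ln_fact (2 * M) - 2 * ln_fact M.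
Proof.
  rewrite !ln_fact_factorization. unfold theta.
  rewrite <- (psum_truncate (fun p => ln (INR p)) M (2 * M)) by lia.
  rewrite <- (psum_truncate (fun p => val_fact p M * ln (INR p)) M (2 * M)) by lia.
  apply Rplus_le_reg_r with
    (psum (fun n => if (n <=? M)%nat then ln (INR n) else 0) (2 * M) +
     2 * psum (fun n => if (n <=? M)%nat then val_fact n M * ln (INR n) else 0) (2 * M)).
  ring_simplify. rewrite <- !psum_scal, <- !psum_plus. apply psum_le.
  intros p Hp Hle. pose proof (is_prime_ge2 p Hp) as H2.
  pose proof (prime_INR_ge2 p Hp). assert (0 <= ln (INR p)) by (apply ln_ge0; lra).
  destruct (Nat.leb_spec p M).
  - pose proof (val_fact_double p M H2). nra.
  - rewrite val_fact_rec by easy. pose proof (val_fact_ge0 p (2 * M / p)).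
    assert (H5 : (1 <= 2 * M / p)%nat) by (apply Nat.div_le_lower_bound; lia).
    apply INR_ge1 in H5. nra.
Qed.

(** By Stirling the difference is at most [2 M ln 2 + ln (2 M) + 1], where [ln 2 <= 1] and
    [ln (2 M) <= 2 M - 1]. *)
Lemma ln_fact_double M : (1 <= M)%nat -> ln_fact (2 * M) - 2 * ln_fact M <= 4 * INR M.
Proof.
  intros HM. pose proof (INR_ge1 M HM).
  pose proof (ln_fact_bounds M HM) as [H1 _].
  pose proof (ln_fact_bounds (2 * M) ltac:(lia)) as [_ H2].
  rewrite mult_INR in H2. simpl (INR 2) in H2. replace (1 + 1) with 2 in H2 by ring.
  pose proof (ln_le_sub1 (2 * INR M) ltac:(lra)).
  rewrite ln_mult in * by lra.
  pose proof (ln_le_sub1 2 ltac:(lra)). nra.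
Qed.

(** Chebyshev's bound by halving. The constant 6 is fixed by the odd case: [6 M] from induction,
    [4 M] from the central binomial coefficient and [2 M] from the possible prime [2 M + 1] add up
    to [12 M]. *)
Lemma theta_le N : theta N <= 6 * INR N.
Proof.
  induction N as [N IH] using lt_wf_ind.
  destruct (Nat.eq_dec N 0) as [->|HN0]; [unfold theta, psum; simpl; lra|].
  destruct (Nat.eq_dec N 1) as [->|HN1].
  { unfold theta, psum. simpl. rewrite ln_1. destruct (primeb 1); lra. }
  destruct (Nat.Even_or_Odd N) as [[M ->]|[M ->]].
  - pose proof (theta_double M). pose proof (ln_fact_double M ltac:(lia)).
    pose proof (IH M ltac:(lia)). rewrite mult_INR. simpl (INR 2).
    pose proof (pos_INR M). lra.
  - pose proof (theta_double M). pose proof (ln_fact_double M ltac:(lia)).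
    pose proof (IH M ltac:(lia)).
    replace (2 * M + 1)%nat with (S (2 * M)) by lia.
    unfold theta in *. rewrite psum_step, S_INR, mult_INR. simpl (INR 2).
    pose proof (INR_ge1 M ltac:(lia)).
    pose proof (ln_le_sub1 (2 * INR M + 1) ltac:(lra)).
    assert (0 <= ln (2 * INR M + 1)) by (apply ln_ge0; lra).
    replace (1 + 1) with 2 by ring.
    destruct (primeb (S (2 * M))); lra.
Qed.

(** * Mertens' first theorem *)

(** The right-hand side is chosen so that its increment dominates the next term. The term at
    [n = 1], a division by zero, is 0 because [ln 1 = 0]. *)
Lemma nsum_ln_div_le N :
  (1 <= N)%nat ->
  nsum (fun n => ln (INR n) / (INR n * (INR n - 1))) N <= 2 - (ln (INR N) + 2) / INR N.
Proof.
  induction 1 as [|N HN IH].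
  - simpl. rewrite ln_1. unfold Rdiv. lra.
  - cbn [nsum]. pose proof (ln_S_sub N HN) as [_ H2]. pose proof (INR_ge1 N HN).
    set (a := ln (INR N)) in *. set (b := ln (INR (S N))) in *.
    rewrite S_INR in *. replace (INR N + 1 - 1) with (INR N) by ring.
    set (x := INR N) in *.
    enough (b / ((x + 1) * x) <= (a + 2) / x - (b + 2) / (x + 1)) by lra.
    apply Rle_trans with ((b - / x + 2) / x - (b + 2) / (x + 1)).
    + replace ((b - / x + 2) / x - (b + 2) / (x + 1))
        with (b / ((x + 1) * x) + (x - 1) / (x * x * (x + 1))) by (field; lra).
      assert (0 <= (x - 1) / (x * x * (x + 1))); [|lra].
      apply Rmult_le_pos; [lra|]. left. apply Rinv_0_lt_compat. nra.
    + apply Rplus_le_compat_r. apply Rmult_le_compat_r; [|lra].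
      left. apply Rinv_0_lt_compat. lra.
Qed.

Lemma ln_div_ge0 n : (1 <= n)%nat -> 0 <= ln (INR n) / (INR n * (INR n - 1)).
Proof.
  intros Hn. destruct (Nat.eq_dec n 1) as [->|H1].
  - simpl. rewrite ln_1. unfold Rdiv. lra.
  - assert (2 <= INR n) by (apply INR_ge2; lia).
    apply Rmult_le_pos; [apply ln_ge0; lra|]. left. apply Rinv_0_lt_compat. nra.
Qed.

Lemma psum_ln_div_le N :
  psum (fun p => ln (INR p) / (INR p * (INR p - 1))) N <= 2.
Proof.
  destruct N as [|N]; [unfold psum; simpl; lra|].
  pose proof (nsum_ln_div_le (S N) ltac:(lia)).
  assert (0 <= (ln (INR (S N)) + 2) / INR (S N)).
  { pose proof (INR_ge1 (S N) ltac:(lia)). pose proof (ln_ge0 _ H0).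
    apply Rmult_le_pos; [lra|]. left. apply Rinv_0_lt_compat. lra. }
  eapply Rle_trans; [apply psum_le_nsum; intros; apply ln_div_ge0; lia|lra].
Qed.

Definition mertens_sum (N : nat) : R := psum (fun p => ln (INR p) / INR p) N.

(** Since [N / p <= val_fact p N + 1], weighting by [ln p] bounds [N] times the sum by
    [ln N! + theta N]. *)
Lemma mertens_sum_le N : (1 <= N)%nat -> mertens_sum N <= ln (INR N) + 6.
Proof.
  intros HN. pose proof (INR_ge1 N HN).
  assert (H1 : INR N * mertens_sum N <= ln_fact N + theta N).
  { rewrite ln_fact_factorization. unfold mertens_sum, theta.
    rewrite <- psum_scal, <- psum_plus. apply psum_le. intros p Hp _.
    pose proof (val_fact_ge p N (is_prime_ge2 p Hp)). pose proof (prime_INR_ge2 p Hp).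
    assert (0 <= ln (INR p)) by (apply ln_ge0; lra).
    unfold Rdiv in *. nra. }
  pose proof (ln_fact_le N HN). pose proof (theta_le N).
  apply Rmult_le_reg_l with (INR N); lra.
Qed.

(** Here [val_fact p N <= N / (p - 1) = N * (1 / p + 1 / (p (p - 1)))]. The second part costs 2 and
    Stirling's formula costs 1. *)
Lemma mertens_sum_ge N : (1 <= N)%nat -> ln (INR N) - 3 <= mertens_sum N.
Proof.
  intros HN. pose proof (INR_ge1 N HN).
  assert (H1 : ln_fact N <= INR N * (mertens_sum N + 2)).
  { rewrite ln_fact_factorization. unfold mertens_sum.
    apply Rle_trans with (INR N * (psum (fun p => ln (INR p) / INR p) N +
      psum (fun p => ln (INR p) / (INR p * (INR p - 1))) N)).
    - rewrite <- psum_plus, <- psum_scal. apply psum_le. intros p Hp _.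
      pose proof (val_fact_le p N (is_prime_ge2 p Hp)). pose proof (prime_INR_ge2 p Hp).
      assert (0 <= ln (INR p)) by (apply ln_ge0; lra).
      replace (INR N * (ln (INR p) / INR p + ln (INR p) / (INR p * (INR p - 1))))
        with (INR N / (INR p - 1) * ln (INR p)) by (field; lra). nra.
    - apply Rmult_le_compat_l; [lra|]. pose proof (psum_ln_div_le N). lra. }
  pose proof (ln_fact_bounds N HN) as [H2 _].
  apply Rmult_le_reg_l with (INR N); lra.
Qed.

Definition recip_sum (N : nat) : R := psum (fun p => / INR p) N.

(* Abel summation against [1 / ln n], packaged as a monotone quantity; the shift by [3]
   makes the Mertens remainder nonnegative. *)
Definition recip_potential (n : nat) : R :=
  recip_sum n - ln (ln (INR n))
    - (mertens_sum n - ln (INR n) + 3) / ln (INR n) - / ln (INR n).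

(** With [a = ln n] and [b = ln (n + 1)], the Mertens remainder contributes a nonnegative multiple
    of [1 / a - 1 / b]. What is left is [(b - a) / b - (ln b - ln a)], and its possible deficit is
    paid by the term [- / ln n], as [b - a <= 1]. *)
Lemma recip_potential_step n :
  (2 <= n)%nat -> recip_potential n <= recip_potential (S n).
Proof.
  intros Hn. pose proof (INR_ge2 n Hn). unfold recip_potential.
  assert (E : recip_sum (S n) - recip_sum n
              = (mertens_sum (S n) - mertens_sum n) / ln (INR (S n))).
  { unfold recip_sum, mertens_sum. rewrite !psum_step.
    assert (0 < ln (INR (S n))) by (apply ln_gt0; rewrite S_INR; lra).
    assert (0 < INR (S n)) by (rewrite S_INR; lra).
    destruct (primeb (S n)); field; lra. }
  pose proof (mertens_sum_ge n ltac:(lia)) as H1.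
  assert (0 < ln (INR n)) by (apply ln_gt0; lra).
  pose proof (ln_S_sub n ltac:(lia)) as [H2 H3].
  assert (/ INR n <= 1) by (rewrite <- Rinv_1; apply Rinv_le_contravar; lra).
  assert (0 < / INR (S n)) by (apply Rinv_0_lt_compat; rewrite S_INR; lra).
  set (a := ln (INR n)) in *. set (b := ln (INR (S n))) in *.
  pose proof (ln_diff_le a b ltac:(lra) ltac:(lra)) as H6.
  set (T := mertens_sum n) in *. set (T' := mertens_sum (S n)) in *.
  assert (/ b <= / a) by (apply Rinv_le_contravar; lra).
  replace (recip_sum (S n)) with (recip_sum n + (T' - T) / b) by lra.
  assert (E1 : (T' - T) / b - (T' - b + 3) / b + (T - a + 3) / a
     = (b - a) / b + (T - a + 3) * (/ a - / b)) by (field; lra).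
  assert (0 <= (T - a + 3) * (/ a - / b)) by (apply Rmult_le_pos; lra).
  assert (E2 : (b - a) / a - (b - a) / b = (b - a) * (/ a - / b)) by (field; lra).
  assert ((b - a) * (/ a - / b) <= 1 * (/ a - / b)) by (apply Rmult_le_compat_r; lra).
  lra.
Qed.

Lemma recip_sum_growth x y :
  (2 <= x <= y)%nat ->
  ln (ln (INR y)) - ln (ln (INR x)) - 10 / ln (INR x) <= recip_sum y - recip_sum x.
Proof.
  intros [Hx Hxy].
  assert (H : recip_potential x <= recip_potential y).
  { induction Hxy as [|y Hxy IH]; [lra|].
    pose proof (recip_potential_step y ltac:(lia)). lra. }
  unfold recip_potential in H.
  pose proof (INR_ge2 x Hx). pose proof (INR_ge2 y ltac:(lia)).
  assert (0 < ln (INR x)) by (apply ln_gt0; lra).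
  assert (0 < ln (INR y)) by (apply ln_gt0; lra).
  pose proof (mertens_sum_ge y ltac:(lia)). pose proof (mertens_sum_le x ltac:(lia)).
  assert (0 < / ln (INR x)) by now apply Rinv_0_lt_compat.
  assert (0 < / ln (INR y)) by now apply Rinv_0_lt_compat.
  assert (0 <= (mertens_sum y - ln (INR y) + 3) / ln (INR y))
    by (apply Rmult_le_pos; lra).
  (* The 10 of the statement is this 9, from [6 + 3], plus the 1 of the term [/ ln x]. *)
  assert ((mertens_sum x - ln (INR x) + 3) / ln (INR x) <= 9 / ln (INR x))
    by (apply Rmult_le_compat_r; lra).
  unfold Rdiv in *. lra.
Qed.

(** * Euler products *)

Fixpoint rough (x n : nat) : bool :=
  match x with
  | O => true
  | S k => (rough k n && negb (primeb (S k) && dvdb (S k) n))%bool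
  end.

Lemma rough_one x : rough x 1 = true.
Proof.
  induction x as [|x IH]; simpl; [easy|]. rewrite IH.
  destruct (primeb (S x)) eqn:E; [|easy].
  apply primeb_true, is_prime_ge2 in E.
  rewrite (proj2 (dvdb_false (S x) 1)); [easy|].
  intros H%Nat.divide_1_r. lia.
Qed.

Lemma rough_mul_prime x p m : is_prime p -> (x < p)%nat -> rough x (p * m) = rough x m.
Proof.
  intros Hp. induction x as [|x IH]; intros Hx; [easy|]. cbn [rough].
  rewrite IH by lia. destruct (primeb (S x)) eqn:E; [|easy].
  apply primeb_true in E. do 2 f_equal. simpl.
  destruct (dvdb (S x) m) eqn:Em.
  - apply dvdb_true in Em. apply dvdb_true. now apply Nat.divide_mul_r.
  - apply dvdb_false in Em. apply dvdb_false. intros [H|H]%prime_divides_mul; [|easy|easy].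
    apply (prime_divides_prime _ _ E Hp) in H. lia.
Qed.

Definition rough_sum (f : nat -> R) (x X : nat) : R :=
  nsum (fun n => if rough x n then f n else 0) X.

Section EulerProduct.

Variable f : nat -> R.
Hypothesis f_ge0 : forall n, 0 <= f n.
Hypothesis f_one : f 1%nat = 1.
Hypothesis f_mul : forall m n, (1 <= m)%nat -> (1 <= n)%nat -> f (m * n)%nat = f m * f n.
Hypothesis f_lt1 : forall p, is_prime p -> f p < 1.

Lemma rough_sum_ge0 x X : 0 <= rough_sum f x X.
Proof. apply nsum_ge0. intros n _. destruct (rough x n); [easy|lra]. Qed.

Lemma rough_sum_mono x X Y : (X <= Y)%nat -> rough_sum f x X <= rough_sum f x Y.
Proof. apply nsum_le_bound. intros n _. destruct (rough x n); [easy|lra]. Qed.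

(** With [p = S x], an [x]-rough [n] is either prime to [p] or of the form [p * m] with [m] again
    [x]-rough. *)
Lemma rough_sum_sieve x X :
  is_prime (S x) ->
  rough_sum f x X = rough_sum f (S x) X + f (S x) * rough_sum f x (X / S x).
Proof.
  intros Hp. unfold rough_sum. rewrite <- nsum_scal.
  rewrite (nsum_ext _ (fun n => (if rough (S x) n then f n else 0) +
    (if dvdb (S x) n then (if rough x n then f n else 0) else 0)) X).
  2:{ intros n _. cbn [rough]. rewrite (proj2 (primeb_true (S x)) Hp).
      destruct (rough x n), (dvdb (S x) n); simpl; ring. }
  rewrite nsum_plus, nsum_multiples by lia. f_equal. apply nsum_ext.
  intros m Hm. rewrite rough_mul_prime by (easy || lia).
  destruct (rough x m); [|ring]. apply f_mul; lia.
Qed.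

(** Finite form of multiplying by [1 + q + ... + q^J] with [q = f p], [p = S x]: for [(S x)]-rough
    [n <= Y] the products [p^j n] with [j <= J] are [x]-rough and at most [p^J * Y]. *)
Lemma rough_sum_iterate x Y J :
  is_prime (S x) ->
  (1 - f (S x) ^ S J) * rough_sum f (S x) Y
    <= (1 - f (S x)) * rough_sum f x (S x ^ J * Y).
Proof.
  intros Hp. pose proof (f_lt1 _ Hp). pose proof (f_ge0 (S x)).
  induction J as [|J IH].
  - rewrite Nat.pow_0_r, Nat.mul_1_l, pow_1. rewrite (rough_sum_sieve x Y Hp).
    pose proof (rough_sum_ge0 x (Y / S x)). apply Rmult_le_compat_l; nra.
  - rewrite (rough_sum_sieve x (S x ^ S J * Y) Hp).
    replace (S x ^ S J * Y / S x)%nat with (S x ^ J * Y)%nat.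
    2:{ symmetry. replace (S x ^ S J * Y)%nat with (S x ^ J * Y * S x)%nat
          by (rewrite Nat.pow_succ_r'; ring).
        apply Nat.div_mul. lia. }
    assert (H1 : rough_sum f (S x) Y <= rough_sum f (S x) (S x ^ S J * Y)).
    { apply rough_sum_mono.
      assert (S x ^ S J <> 0)%nat by (apply Nat.pow_nonzero; lia). nia. }
    set (q := f (S x)) in *. rewrite <- (tech_pow_Rmult q (S J)).
    apply (Rmult_le_compat_l q) in IH; [|easy].
    apply (Rmult_le_compat_l (1 - q)) in H1; [|lra]. lra.
Qed.

(** Each sieved prime gains a factor [1 - f p]. The bound must hold for every cutoff [X], because
    the induction step uses it at [p^J * X] with [J] large. *)
Lemma rough_sum_le B x X :
  (forall N, nsum f N <= B) ->
  rough_sum f x X <= B * exp (psum (fun p => ln (1 - f p)) x).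
Proof.
  intros HB. revert X. induction x as [|x IH]; intros X.
  - unfold psum. simpl. rewrite exp_0, Rmult_1_r. apply HB.
  - rewrite psum_step. destruct (primeb (S x)) eqn:E.
    + apply primeb_true in E. pose proof (f_lt1 _ E). pose proof (f_ge0 (S x)).
      rewrite exp_plus, exp_ln by lra.
      set (C := B * exp (psum (fun p => ln (1 - f p)) x)) in *.
      replace (B * _) with ((1 - f (S x)) * C) by (unfold C; ring).
      set (q := f (S x)) in *. set (Z := rough_sum f (S x) X).
      destruct (Rle_lt_dec Z ((1 - q) * C)) as [|Hlt]; [easy|exfalso].
      assert (HC : 0 <= C) by (apply Rle_trans with (2 := IH O); apply rough_sum_ge0).
      assert (0 <= (1 - q) * C) by (apply Rmult_le_pos; lra).
      (* If the sum [Z] exceeded [(1 - q) * C], then [(1 - q^(J+1)) * Z] would exceed it too for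
         large [J], against [rough_sum_iterate]. *)
      destruct (pow_lt_1_zero q) with (y := (Z - (1 - q) * C) / Z) as [J HJ].
      { rewrite Rabs_pos_eq; lra. }
      { apply Rdiv_lt_0_compat; lra. }
      specialize (HJ (S J) ltac:(lia)).
      rewrite Rabs_pos_eq in HJ by (apply pow_le; lra).
      pose proof (rough_sum_iterate x X J E) as H3. fold q Z in H3.
      pose proof (IH (S x ^ J * X)%nat).
      assert ((1 - q) * rough_sum f x (S x ^ J * X) <= (1 - q) * C)
        by (apply Rmult_le_compat_l; lra).
      apply (Rmult_lt_compat_r Z) in HJ; [|lra].
      unfold Rdiv in HJ. rewrite Rmult_assoc, Rinv_l in HJ by lra. lra.
    + rewrite Rplus_0_r. apply Rle_trans with (2 := IH X). apply nsum_le.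
      intros n _. cbn [rough]. rewrite E. simpl. rewrite Bool.andb_true_r. lra.
Qed.

(** At cutoff 1 the rough sum is the single term [f 1 = 1], so 1 is at most [B] times the product of
    the [1 - f p]. *)
Lemma euler_product_le B x :
  (forall N, nsum f N <= B) -> 0 <= ln B + psum (fun p => ln (1 - f p)) x.
Proof.
  intros HB. pose proof (rough_sum_le B x 1 HB) as H. unfold rough_sum in H.
  simpl in H. rewrite rough_one, f_one in H.
  assert (0 < B) by (specialize (HB 1%nat); simpl in HB; lra).
  rewrite <- (ln_exp (psum _ x)), <- ln_mult by (easy || apply exp_pos).
  apply ln_ge0. lra.
Qed.

End EulerProduct.

(** * The zeta function near 1 and the twisted Euler product *)

Lemma one_sub_le_Rpower x d : 0 < x -> 1 - d * ln x <= Rpower x (- d).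
Proof.
  intros Hx. unfold Rpower. pose proof (exp_ineq1_le (- d * ln x)). lra.
Qed.

Lemma Rpower_le1 x d : 1 <= x -> 0 <= d -> Rpower x (- d) <= 1.
Proof.
  intros Hx Hd. rewrite <- (Rpower_O x) by lra.
  apply Rle_Rpower; lra.
Qed.

Lemma Rpower_gt0 x y : 0 < Rpower x y.
Proof. apply exp_pos. Qed.

(** Telescoping: [(n+1)^(-1-d) <= (n^(-d) - (n+1)^(-d)) / d], from [exp y >= 1 + y] and
    [ln (n+1) - ln n >= 1 / (n+1)]. *)
Lemma zeta_partial_le d N : 0 < d ->
  nsum (fun n => Rpower (INR n) (- d) / INR n) N <= 1 + / d.
Proof.
  intros Hd. assert (0 < / d) by now apply Rinv_0_lt_compat.
  destruct N as [|N]; [simpl; lra|].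
  enough (H1 : nsum (fun n => Rpower (INR n) (- d) / INR n) (S N)
         <= 1 + / d * (1 - Rpower (INR (S N)) (- d))).
  { pose proof (Rpower_gt0 (INR (S N)) (- d)). nra. }
  induction N as [|N IH].
  - simpl. unfold Rpower at 1 2. rewrite ln_1, Rmult_0_r, exp_0.
    unfold Rdiv. rewrite Rinv_1. lra.
  - cbn [nsum] in *. set (n := S N) in *.
    assert (1 <= INR n) by (apply INR_ge1; lia).
    pose proof (ln_S_sub n ltac:(lia)) as [H1 _].
    enough (Rpower (INR (S n)) (- d) / INR (S n)
            <= / d * (Rpower (INR n) (- d) - Rpower (INR (S n)) (- d))) by nra.
    assert (E : Rpower (INR n) (- d)
        = Rpower (INR (S n)) (- d) * exp (d * (ln (INR (S n)) - ln (INR n)))).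
    { unfold Rpower. rewrite <- exp_plus. f_equal. ring. }
    rewrite E. pose proof (Rpower_gt0 (INR (S n)) (- d)) as H2.
    pose proof (exp_ineq1_le (d * (ln (INR (S n)) - ln (INR n)))) as H3.
    apply (Rmult_le_compat_l d) in H1; [|lra].
    set (P := Rpower (INR (S n)) (- d)) in *. set (e := exp _) in *.
    apply Rle_trans with (/ d * (P * (d * / INR (S n)))).
    + right. field. split; [rewrite S_INR; lra|lra].
    + apply Rmult_le_compat_l; [lra|]. nra.
Qed.

Definition prime_log (p : nat) : R := - ln (1 - / INR p).

(** The function [L] of the introduction. *)
Definition euler_log (N : nat) : R := psum prime_log N.

Lemma inv_prime_bounds p : is_prime p -> 0 < / INR p <= / 2.
Proof.
  intros Hp%prime_INR_ge2. split; [apply Rinv_0_lt_compat; lra|].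
  apply Rinv_le_contravar; lra.
Qed.

Lemma prime_log_ge p : is_prime p -> / INR p <= prime_log p.
Proof.
  intros Hp%inv_prime_bounds. unfold prime_log.
  pose proof (ln_le_sub1 (1 - / INR p) ltac:(lra)). lra.
Qed.

Lemma prime_log_le p : is_prime p -> prime_log p <= 2 / INR p.
Proof.
  intros Hp. pose proof (inv_prime_bounds p Hp). pose proof (prime_INR_ge2 p Hp).
  unfold prime_log.
  pose proof (ln_diff_le (1 - / INR p) 1 ltac:(lra) ltac:(lra)) as H1.
  rewrite ln_1 in H1.
  assert ((1 - (1 - / INR p)) / (1 - / INR p) <= 2 / INR p); [|lra].
  replace ((1 - (1 - / INR p)) / (1 - / INR p)) with (/ (INR p - 1)) by (field; lra).
  replace (2 / INR p) with (/ (INR p / 2)) by (field; lra).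
  apply Rinv_le_contravar; lra.
Qed.

Lemma euler_log_mono x y : (x <= y)%nat -> euler_log x <= euler_log y.
Proof.
  apply psum_le_bound. intros p Hp _. pose proof (prime_log_ge p Hp).
  pose proof (inv_prime_bounds p Hp). lra.
Qed.

(** Used with [q = p^(-d)]. The tangent bound for [ln (1 - q / p) - ln (1 - 1 / p)] gives an error
    [(1 - q) / (p - 1)]; its part [(1 - q) / p] is absorbed by [(1 - q) * prime_log p]. *)
Lemma twisted_prime_log_le q p :
  is_prime p -> 0 < q <= 1 ->
  q * prime_log p <= - ln (1 - q / INR p) + (1 - q) / (INR p * (INR p - 1)).
Proof.
  intros Hp Hq. pose proof (inv_prime_bounds p Hp). pose proof (prime_INR_ge2 p Hp).
  pose proof (prime_log_ge p Hp) as H1. unfold prime_log in *.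
  assert (q / INR p <= / INR p) by (unfold Rdiv; nra).
  pose proof (ln_diff_le (1 - / INR p) (1 - q / INR p) ltac:(lra) ltac:(lra)) as Hdiff.
  replace ((1 - q / INR p - (1 - / INR p)) / (1 - / INR p))
    with ((1 - q) / (INR p * (INR p - 1)) + (1 - q) * / INR p) in Hdiff by (field; lra).
  apply (Rmult_le_compat_l (1 - q)) in H1; lra.
Qed.

(** The main term is the Euler product of [n^(-1-d)]. In the error, [1 - p^(-d) <= d * ln p], and
    the sum of [ln p / (p (p - 1))] is at most 2. *)
Lemma twisted_euler_log_le d N : 0 < d ->
  psum (fun p => Rpower (INR p) (- d) * prime_log p) N <= ln (1 + / d) + 2 * d.
Proof.
  intros Hd. set (f := fun n => Rpower (INR n) (- d) / INR n).
  assert (HE : 0 <= ln (1 + / d) + psum (fun p => ln (1 - f p)) N).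
  { apply euler_product_le; unfold f.
    - intros n. destruct n as [|n].
      (* At [n = 0] the convention [/ 0 = 0] makes [f 0 = 0]. *)
      + unfold Rdiv. simpl. rewrite Rinv_0. lra.
      + apply Rmult_le_pos; [left; apply Rpower_gt0|].
        left. apply Rinv_0_lt_compat, lt_0_INR. lia.
    - simpl. unfold Rpower, Rdiv. rewrite ln_1, Rmult_0_r, exp_0. lra.
    - intros m n Hm%INR_ge1 Hn%INR_ge1. rewrite mult_INR, <- Rpower_mult_distr by lra.
      field. lra.
    - intros p Hp. pose proof (inv_prime_bounds p Hp). pose proof (prime_INR_ge2 p Hp).
      pose proof (Rpower_le1 (INR p) d ltac:(lra) ltac:(lra)). unfold Rdiv. nra.
    - intros n. now apply zeta_partial_le. }
  pose proof (psum_ln_div_le N) as H2.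
  apply Rle_trans with (psum (fun p => - 1 * ln (1 - f p) +
     d * (ln (INR p) / (INR p * (INR p - 1)))) N).
  - apply psum_le. intros p Hp _. pose proof (prime_INR_ge2 p Hp).
    pose proof (Rpower_le1 (INR p) d ltac:(lra) ltac:(lra)).
    pose proof (twisted_prime_log_le (Rpower (INR p) (- d)) p Hp) as H3.
    pose proof (Rpower_gt0 (INR p) (- d)).
    specialize (H3 ltac:(lra)). unfold f.
    pose proof (one_sub_le_Rpower (INR p) d ltac:(lra)).
    apply Rle_trans with (1 := H3).
    enough ((1 - Rpower (INR p) (- d)) / (INR p * (INR p - 1))
       <= d * (ln (INR p) / (INR p * (INR p - 1)))) by lra.
    unfold Rdiv. rewrite <- Rmult_assoc. apply Rmult_le_compat_r; [|lra].
    left. apply Rinv_0_lt_compat. nra.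
  - rewrite psum_plus, !psum_scal.
    apply (Rmult_le_compat_l d) in H2; lra.
Qed.

(** * The harmonic series and the logarithmic series *)

Definition harmonic (N : nat) : R := nsum (fun n => / INR n) N.

Lemma harmonic_sum_f_R0 n : sum_f_R0 (fun k => / INR (S k)) n = harmonic (S n).
Proof.
  induction n as [|n IH]; [unfold harmonic; cbn [sum_f_R0 nsum]; ring|].
  cbn [sum_f_R0]. rewrite IH. easy.
Qed.

Lemma harmonic_ge_ln_S n : ln (INR (S n)) <= harmonic n.
Proof.
  induction n as [|n IH].
  - unfold harmonic. simpl. rewrite ln_1. lra.
  - unfold harmonic in *. cbn [nsum].
    pose proof (ln_S_sub (S n) ltac:(lia)). lra.
Qed.

(** The epsilon choice meets its specification because the sequence decreases and is bounded below
    by 0. *)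
Lemma euler_gamma_cv :
  Un_cv (fun n => sum_f_R0 (fun k => / INR (S k)) n - ln (INR (S n))) euler_gamma.
Proof.
  unfold euler_gamma. apply epsilon_spec.
  destruct (decreasing_cv
    (fun n => sum_f_R0 (fun k => / INR (S k)) n - ln (INR (S n)))) as [l Hl].
  - intros n. rewrite !harmonic_sum_f_R0. unfold harmonic. cbn [nsum].
    pose proof (ln_S_sub (S n) ltac:(lia)). lra.
  - exists 0. intros x [n ->]. unfold opp_seq. rewrite harmonic_sum_f_R0.
    pose proof (harmonic_ge_ln_S (S n)). pose proof (ln_S_sub (S n) ltac:(lia)) as [H1 _].
    assert (0 < / INR (S (S n))) by (apply Rinv_0_lt_compat, lt_0_INR; lia). lra.
  - now exists l.
Qed.

Lemma harmonic_le_eventually eps :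
  0 < eps -> exists m0, forall m, (m0 <= m)%nat ->
    harmonic m <= ln (INR m) + euler_gamma + eps.
Proof.
  intros He. destruct (euler_gamma_cv eps He) as [N HN]. exists (S N).
  intros [|m] Hm; [lia|]. specialize (HN m ltac:(lia)).
  unfold Rdist in HN. rewrite harmonic_sum_f_R0 in HN.
  apply Rabs_def2 in HN. lra.
Qed.

Lemma harmonic_mono m n : (m <= n)%nat -> harmonic m <= harmonic n.
Proof.
  apply nsum_le_bound. intros k Hk. left. apply Rinv_0_lt_compat, lt_0_INR. lia.
Qed.

Lemma nsum_geometric x M : nsum (fun m => x ^ (m - 1)) M * (1 - x) = 1 - x ^ M.
Proof.
  induction M as [|M IH]; cbn [nsum]; [simpl; ring|].
  rewrite Rmult_plus_distr_r, IH. simpl. rewrite Nat.sub_0_r. ring.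
Qed.

Lemma log_series_derivative M x : x < 1 ->
  derivable_pt_lim (fun x => nsum (fun m => x ^ m / INR m) M + ln (1 - x)) x
    (- (x ^ M / (1 - x))).
Proof.
  intros Hx.
  replace (- (x ^ M / (1 - x)))
    with (nsum (fun m => x ^ (m - 1)) M + / (1 - x) * (- 1)).
  2:{ pose proof (nsum_geometric x M).
      apply Rmult_eq_reg_r with (1 - x); [|lra].
      rewrite Rmult_plus_distr_r, H. field. lra. }
  apply (derivable_pt_lim_plus (fun x => nsum (fun m => x ^ m / INR m) M)
           (fun x => ln (1 - x))).
  - induction M as [|M IH]; cbn [nsum].
    + apply derivable_pt_lim_const.
    + apply (derivable_pt_lim_plus (fun x => nsum (fun m => x ^ m / INR m) M)
           (fun x => x ^ S M / INR (S M))); [easy|].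
      replace (x ^ (S M - 1)) with (/ INR (S M) * (INR (S M) * x ^ pred (S M))).
      2:{ simpl pred. replace (S M - 1)%nat with M by lia. field.
          apply not_0_INR. lia. }
      apply derivable_pt_lim_ext with (f := mult_real_fct (/ INR (S M)) (fun x => x ^ S M)).
      { intros z. unfold mult_real_fct. field. apply not_0_INR. lia. }
      apply derivable_pt_lim_scal. apply derivable_pt_lim_pow.
  - apply (derivable_pt_lim_comp (fun x => 1 - x) ln).
    + replace (-1) with (0 - 1) by ring.
      apply (derivable_pt_lim_minus (fun _ => 1) id);
        [apply derivable_pt_lim_const|apply derivable_pt_lim_id].
    + apply derivable_pt_lim_ln. lra.
Qed.

(** Mean value theorem on [[0, r]]: the derivative of partial sum plus [ln (1 - x)] is
    [- x^M / (1 - x)], largest in size at [r]. *)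
Lemma log_series_ge r M : 0 < r < 1 ->
  - ln (1 - r) - r ^ M / (1 - r) <= nsum (fun m => r ^ m / INR m) M.
Proof.
  intros Hr.
  destruct (MVT_cor2 (fun x => nsum (fun m => x ^ m / INR m) M + ln (1 - x))
     (fun x => - (x ^ M / (1 - x))) 0 r) as [c [Hc1 Hc2]]; [lra| |].
  { intros c Hc. apply log_series_derivative. lra. }
  assert (E : nsum (fun m => 0 ^ m / INR m) M = 0).
  { rewrite (nsum_ext _ (fun _ => 0)); [apply nsum_zero|].
    intros n Hn. rewrite pow_i by lia. unfold Rdiv. ring. }
  rewrite E, Rminus_0_r, Rminus_0_r, ln_1 in Hc1.
  assert (c ^ M / (1 - c) * r <= r ^ M / (1 - r)); [|lra].
  assert (0 < / (1 - r)) by (apply Rinv_0_lt_compat; lra).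
  assert (0 < / (1 - c)) by (apply Rinv_0_lt_compat; lra).
  assert (/ (1 - c) <= / (1 - r)) by (apply Rinv_le_contravar; lra).
  assert (0 <= c ^ M) by (apply pow_le; lra).
  assert (c ^ M <= r ^ M) by (apply pow_incr; lra).
  apply Rle_trans with (c ^ M / (1 - c) * 1).
  - apply Rmult_le_compat_l; [|lra]. apply Rmult_le_pos; lra.
  - rewrite Rmult_1_r. apply Rmult_le_compat; lra.
Qed.

(** * Mertens' third theorem, upper bound *)

Lemma psum_block_le f g c a b :
  (forall p, is_prime p -> (a < p <= b)%nat -> c * f p <= g p) -> (a <= b)%nat ->
  c * (psum f b - psum f a) <= psum g b - psum g a.
Proof.
  intros H Hab. induction Hab as [|b Hab IH]; [lra|].
  rewrite !psum_step. specialize (IH ltac:(intros; apply H; easy || lia)).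
  destruct (primeb (S b)) eqn:E; [|lra].
  apply primeb_true in E. specialize (H (S b) E ltac:(lia)). lra.
Qed.

(** A prime [p] of the block [(2^(m-1), 2^m]] has [p^(-d) >= 2^(-d m)]. *)
Lemma dyadic_euler_log_le d M : 0 < d ->
  nsum (fun m => Rpower 2 (- d) ^ m * (euler_log (2 ^ m) - euler_log (2 ^ (m - 1)))) M
    <= psum (fun p => Rpower (INR p) (- d) * prime_log p) (2 ^ M).
Proof.
  intros Hd. induction M as [|M IH].
  - apply nsum_ge0. intros n Hn. destruct (primeb n) eqn:E; [|lra].
    apply primeb_true in E. pose proof (prime_log_ge n E).
    pose proof (inv_prime_bounds n E). apply Rmult_le_pos; [|lra].
    left. apply Rpower_gt0.
  - cbn [nsum]. replace (S M - 1)%nat with M by lia.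
    enough (Rpower 2 (- d) ^ S M * (euler_log (2 ^ S M) - euler_log (2 ^ M)) <=
      psum (fun p => Rpower (INR p) (- d) * prime_log p) (2 ^ S M) -
      psum (fun p => Rpower (INR p) (- d) * prime_log p) (2 ^ M)) by lra.
    apply psum_block_le.
    + intros p Hp Hle. pose proof (prime_log_ge p Hp). pose proof (inv_prime_bounds p Hp).
      pose proof (prime_INR_ge2 p Hp).
      apply Rmult_le_compat_r; [lra|].
      rewrite <- Rpower_pow by apply Rpower_gt0. rewrite Rpower_mult.
      unfold Rpower. apply exp_le.
      assert (ln (INR p) <= INR (S M) * ln 2).
      { rewrite <- ln_pow by lra. apply ln_le; [lra|].
        replace (2 ^ S M) with (INR (2 ^ S M)) by (rewrite pow_INR; f_equal; simpl; ring).
        apply le_INR. lia. }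
      nra.
    + apply Nat.pow_le_mono_r; lia.
Qed.

(* [E] only has to dominate [l] from [m0] on: as [r] tends to [1] the weight of the
   initial segment vanishes. *)
Lemma abel_geometric_ge (E : nat -> R) r l K m0 M :
  0 < r < 1 -> E O = 0 -> (forall m, (m < m0)%nat -> l - K <= E m) ->
  (forall m, (m0 <= m)%nat -> l <= E m) -> (m0 <= M)%nat ->
  l - K * (1 - r ^ m0) <= nsum (fun m => r ^ m * (E m - E (m - 1)%nat)) M.
Proof.
  intros Hr HE0 Hlow Hhigh HM.
  set (s := nsum (fun m => r ^ m * (E m - E (m - 1)%nat))).
  (* Summation by parts: [s m - r^m * E m] collects the values [E j] with nonnegative weights
     [r^j - r^(j+1)], which telescope. *)
  assert (Hstep : forall m, s (S m) - r ^ S m * E (S m) =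
            s m - r ^ m * E m + (r ^ m - r ^ S m) * E m).
  { intros m. unfold s. cbn [nsum]. replace (S m - 1)%nat with m by lia. ring. }
  assert (Hdec : forall m, 0 <= r ^ m - r ^ S m).
  { intros m. simpl. pose proof (pow_lt r m ltac:(lra)). nra. }
  assert (H1 : forall m, (m <= m0)%nat -> (l - K) * (1 - r ^ m) <= s m - r ^ m * E m).
  { induction m as [|m IH]; intros Hm.
    - unfold s. simpl. rewrite HE0. lra.
    - rewrite Hstep. specialize (IH ltac:(lia)). specialize (Hlow m ltac:(lia)).
      specialize (Hdec m). nra. }
  assert (H2 : (l - K) * (1 - r ^ m0) + l * (r ^ m0 - r ^ M) <= s M - r ^ M * E M).
  { clear Hlow. induction HM as [|M HM IH].
    - specialize (H1 m0 ltac:(lia)). lra.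
    - rewrite Hstep. specialize (Hhigh M HM). specialize (Hdec M). nra. }
  specialize (Hhigh M HM). pose proof (pow_lt r M ltac:(lra)). nra.
Qed.

Lemma euler_log_one : euler_log 1 = 0.
Proof.
  unfold euler_log, psum. simpl. destruct (primeb 1) eqn:E; [|ring].
  apply primeb_true, is_prime_ge2 in E. lia.
Qed.

Lemma euler_log_ge0 n : 0 <= euler_log n.
Proof. apply (euler_log_mono 0 n). lia. Qed.

Lemma pow2_gt n : (n < 2 ^ n)%nat.
Proof. apply Nat.pow_gt_lin_r. lia. Qed.

(** The increments of [euler_log (2^m)] split into those of [harmonic], which produce the
    logarithmic series, and those of the difference, which Abel summation bounds below. *)
Lemma dyadic_comparison d l K m0 M :
  0 < d ->
  (forall m, (m < m0)%nat -> l - K <= euler_log (2 ^ m) - harmonic m) ->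
  (forall m, (m0 <= m)%nat -> l <= euler_log (2 ^ m) - harmonic m) -> (m0 <= M)%nat ->
  nsum (fun m => Rpower 2 (- d) ^ m / INR m) M + l - K * (1 - Rpower 2 (- d) ^ m0)
    <= ln (1 + / d) + 2 * d.
Proof.
  intros Hd Hlow Hhigh HM. set (r := Rpower 2 (- d)).
  assert (Hr : 0 < r < 1).
  { split; [apply Rpower_gt0|]. unfold r. rewrite <- (Rpower_O 2) by lra.
    apply Rpower_lt; lra. }
  pose proof (abel_geometric_ge (fun m => euler_log (2 ^ m) - harmonic m)
    r l K m0 M Hr) as H1. cbv beta in H1.
  rewrite Nat.pow_0_r, euler_log_one in H1.
  specialize (H1 ltac:(unfold harmonic; simpl; ring) Hlow Hhigh HM).
  pose proof (dyadic_euler_log_le d M Hd) as H2. fold r in H2.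
  pose proof (twisted_euler_log_le d (2 ^ M) Hd) as H3.
  rewrite (nsum_ext _ (fun m => r ^ m / INR m + r ^ m *
    (euler_log (2 ^ m) - harmonic m - (euler_log (2 ^ (m - 1)) - harmonic (m - 1)))))
    in H2.
  - rewrite nsum_plus in H2. lra.
  - intros [|m] Hm; [lia|]. replace (S m - 1)%nat with m by lia.
    unfold harmonic. cbn [nsum]. unfold Rdiv. ring.
Qed.

Lemma no_excess x0 k :
  0 < k -> (2 <= x0)%nat ->
  ~ (forall y, (x0 <= y)%nat -> ln (ln (INR y)) + euler_gamma + k <= euler_log y).
Proof.
  intros Hk Hx0 Hall.
  destruct (harmonic_le_eventually (k / 2) ltac:(lra)) as [m1 Hm1].
  set (m0 := Nat.max m1 x0).
  assert (Hln2 : 0 < ln 2) by (apply ln_gt0; lra).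
  assert (Hln2' : ln 2 <= 1) by (pose proof (ln_le_sub1 2 ltac:(lra)); lra).
  (* At [y = 2^m] one has [ln (ln y) = ln m + ln (ln 2)]; half of [k] pays for replacing
     [ln m + euler_gamma] by [harmonic m]. *)
  set (l := ln (ln 2) + k / 2).
  assert (Hhigh : forall m, (m0 <= m)%nat -> l <= euler_log (2 ^ m) - harmonic m).
  { intros m Hm. pose proof (pow2_gt m).
    specialize (Hall (2 ^ m)%nat ltac:(lia)). specialize (Hm1 m ltac:(lia)).
    rewrite pow_INR in Hall. replace (INR 2) with 2 in Hall by (simpl; ring).
    assert (0 < INR m) by (apply lt_0_INR; lia).
    rewrite ln_pow, ln_mult in Hall by lra. unfold l. lra. }
  set (K := Rabs l + harmonic m0).
  assert (Hh : 0 <= harmonic m0) by (apply (harmonic_mono 0 m0); lia).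
  assert (HK : 0 <= K) by (unfold K; pose proof (Rabs_pos l); lra).
  assert (Hlow : forall m, (m < m0)%nat -> l - K <= euler_log (2 ^ m) - harmonic m).
  { intros m Hm. pose proof (euler_log_ge0 (2 ^ m)).
    pose proof (harmonic_mono m m0 ltac:(lia)). unfold K. pose proof (Rle_abs l). lra. }
  assert (Hm0 : 0 <= INR m0) by apply pos_INR.
  assert (Hden : 0 < 3 + K * INR m0) by nra.
  (* The logarithms of [d] cancel at the end, leaving [k / 2 - k / 8 <= d * (3 + K * m0)]. This [d]
     makes the right side [k / 4], a contradiction. *)
  set (d := k / (4 * (3 + K * INR m0))).
  assert (Hd : 0 < d) by (apply Rdiv_lt_0_compat; lra).
  assert (Hdk : d * (3 + K * INR m0) = k / 4) by (unfold d; field; lra).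
  set (r := Rpower 2 (- d)).
  assert (Hr : 0 < r < 1).
  { split; [apply Rpower_gt0|]. unfold r. rewrite <- (Rpower_O 2) by lra.
    apply Rpower_lt; lra. }
  assert (H1r : 1 - r <= d * ln 2).
  { pose proof (one_sub_le_Rpower 2 d ltac:(lra)). unfold r. lra. }
  assert (Hrm : 1 - r ^ m0 <= d * INR m0).
  { unfold r. rewrite <- Rpower_pow, Rpower_mult by apply Rpower_gt0.
    replace (- d * INR m0) with (- (d * INR m0)) by ring.
    pose proof (one_sub_le_Rpower 2 (d * INR m0) ltac:(lra)).
    assert (0 <= d * INR m0) by nra. nra. }
  destruct (pow_lt_1_zero r) with (y := (1 - r) * (k / 8)) as [J HJ].
  { rewrite Rabs_pos_eq; lra. }
  { apply Rmult_lt_0_compat; lra. }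
  set (M := Nat.max J m0). specialize (HJ M ltac:(lia)).
  rewrite Rabs_pos_eq in HJ by (apply pow_le; lra).
  pose proof (dyadic_comparison d l K m0 M Hd Hlow Hhigh ltac:(lia)) as H1. fold r in H1.
  pose proof (log_series_ge r M Hr) as H2.
  assert (H3 : r ^ M / (1 - r) <= k / 8).
  { apply Rmult_le_reg_r with (1 - r); [lra|]. unfold Rdiv.
    rewrite Rmult_assoc, Rinv_l by lra. lra. }
  assert (H4 : ln (1 - r) <= ln d + ln (ln 2)).
  { rewrite <- ln_mult by lra. apply ln_le; lra. }
  assert (H5 : ln (1 + / d) <= d - ln d).
  { replace (1 + / d) with ((1 + d) / d) by (field; lra).
    rewrite ln_div by lra. pose proof (ln_le_sub1 (1 + d) ltac:(lra)). lra. }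
  apply (Rmult_le_compat_l K) in Hrm; [|easy].
  unfold l in H1. lra.
Qed.

(** An excess at [x] would persist at every [y >= x]: [prime_log p >= 1 / p] transfers the growth of
    [recip_sum] to [euler_log], with loss at most [10 / ln x]. *)
Lemma euler_log_le x :
  (2 <= x)%nat -> euler_log x <= ln (ln (INR x)) + euler_gamma + 10 / ln (INR x).
Proof.
  intros Hx. destruct (Rle_lt_dec (euler_log x)
    (ln (ln (INR x)) + euler_gamma + 10 / ln (INR x))) as [|Hlt]; [easy|exfalso].
  apply (no_excess x (euler_log x - (ln (ln (INR x)) + euler_gamma + 10 / ln (INR x))));
    [lra|easy|].
  intros y Hy. pose proof (recip_sum_growth x y ltac:(lia)) as H1.
  pose proof (psum_block_le (fun p => / INR p) prime_log 1 x y) as H2.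
  unfold euler_log, recip_sum in *.
  specialize (H2 ltac:(intros; rewrite Rmult_1_l; now apply prime_log_ge) Hy). lra.
Qed.

(** * The sum-of-divisors function *)

(** The cutoff [N] is independent of [m], so that [m] and its factors can be compared over one
    range. *)
Definition divisor_sum (N m : nat) : R :=
  nsum (fun d => if dvdb d m then INR d else 0) N.

Lemma sigma_div_divisor_sum m : INR (sigma_div m) = divisor_sum m m.
Proof.
  unfold sigma_div, divisor_sum.
  enough (H : forall N, INR (list_sum (filter (fun d => Nat.eqb (m mod d) 0) (seq 1 N)))
     = nsum (fun d => if dvdb d m then INR d else 0) N) by apply H.
  induction N as [|N IH]; [easy|].
  rewrite seq_S, filter_app, list_sum_app, plus_INR, IH. cbn [nsum]. f_equal.
  cbn [filter]. change (1 + N)%nat with (S N). fold (dvdb (S N) m).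
  destruct (dvdb (S N) m); [|easy].
  unfold list_sum; cbn [fold_right]. now rewrite Nat.add_0_r.
Qed.

Lemma divisor_sum_mono M N m : (M <= N)%nat -> divisor_sum M m <= divisor_sum N m.
Proof.
  apply nsum_le_bound. intros d _. destruct (dvdb d m); [apply pos_INR|lra].
Qed.

Lemma divisor_sum_one N : divisor_sum N 1 <= 1.
Proof.
  destruct N as [|N]; [unfold divisor_sum; simpl; lra|].
  unfold divisor_sum. right.
  transitivity (nsum (fun d => if (d =? 1)%nat then INR d else 0) (S N)).
  2:{ rewrite (nsum_delta INR) by lia. easy. }
  apply nsum_ext. intros d Hd. destruct (Nat.eqb_spec d 1) as [->|Hd1]; [easy|].
  rewrite (proj2 (dvdb_false d 1)); [easy|].
  now intros H%Nat.divide_1_r.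
Qed.

(** A prime dividing both [d] and [p^a] would be [p] itself, so they are coprime and Gauss's lemma
    applies. *)
Lemma divides_prime_power_coprime p a m d :
  is_prime p -> ~ Nat.divide p d -> Nat.divide d (p ^ a * m) -> Nat.divide d m.
Proof.
  intros Hp Hd H. apply Nat.gauss with (p ^ a)%nat; [easy|].
  destruct (Nat.eq_dec (Nat.gcd d (p ^ a)) 1) as [|Hg]; [easy|exfalso].
  assert (Hg0 : Nat.gcd d (p ^ a) <> O).
  { intros [_ H0]%Nat.gcd_eq_0. apply Nat.pow_nonzero in H0; [easy|].
    apply is_prime_ge2 in Hp. lia. }
  destruct (exists_prime_divisor (Nat.gcd d (p ^ a)) ltac:(lia)) as [q [Hq Hqg]].
  assert (Hqd : Nat.divide q d)
    by (eapply Nat.divide_trans; [exact Hqg|apply Nat.gcd_divide_l]).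
  assert (Hqp : Nat.divide q (p ^ a))
    by (eapply Nat.divide_trans; [exact Hqg|apply Nat.gcd_divide_r]).
  enough (q = p) by congruence.
  clear -Hp Hq Hqp. induction a as [|a IH].
  - apply Nat.divide_1_r in Hqp. apply is_prime_ge2 in Hq. lia.
  - rewrite Nat.pow_succ_r' in Hqp.
    apply prime_divides_mul in Hqp as [H|H]; [|now apply IH|easy].
    now apply prime_divides_prime.
Qed.

(** Truncated multiplicativity of sigma. A divisor of [p^(a+1) * m] prime to [p] divides [m]; any
    other is [p] times a divisor of [p^a * m]. *)
Lemma divisor_sum_prime_power N p a m :
  is_prime p -> ~ Nat.divide p m ->
  (INR p - 1) * divisor_sum N (p ^ a * m) <= (INR p ^ S a - 1) * divisor_sum N m.
Proof.
  intros Hp Hm. pose proof (prime_INR_ge2 p Hp) as H2. pose proof (is_prime_ge2 p Hp).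
  induction a as [|a IH].
  - rewrite Nat.pow_0_r, Nat.mul_1_l. lra.
  - assert (H1 : divisor_sum N (p ^ S a * m)
             <= divisor_sum N m + INR p * divisor_sum N (p ^ a * m)).
    { apply Rle_trans with (divisor_sum N m + INR p * divisor_sum (N / p) (p ^ a * m)).
      - unfold divisor_sum. rewrite <- nsum_scal.
        rewrite <- (nsum_ext (fun d => if dvdb (p * d) (p ^ S a * m)
            then INR (p * d) else 0)
          (fun d => INR p * (if dvdb d (p ^ a * m) then INR d else 0)) (N / p)).
        + rewrite <- (nsum_multiples (fun d => if dvdb d (p ^ S a * m)
            then INR d else 0) p N) by lia.
          rewrite <- nsum_plus. apply nsum_le. intros d _. pose proof (pos_INR d).
          destruct (dvdb p d) eqn:E1.
          * destruct (dvdb d (p ^ S a * m)), (dvdb d m); lra.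
          * apply dvdb_false in E1. destruct (dvdb d (p ^ S a * m)) eqn:E3.
            -- apply dvdb_true in E3.
               apply divides_prime_power_coprime in E3; [|easy|easy].
               rewrite (proj2 (dvdb_true d m)) by easy. lra.
            -- destruct (dvdb d m); lra.
        + intros d _. rewrite mult_INR. rewrite Nat.pow_succ_r', <- Nat.mul_assoc.
          destruct (dvdb d (p ^ a * m)) eqn:E1.
          * apply dvdb_true in E1. rewrite (proj2 (dvdb_true _ _)); [easy|].
            now apply Nat.mul_divide_mono_l.
          * apply dvdb_false in E1. rewrite (proj2 (dvdb_false _ _)); [ring|].
            intros H3. apply E1. apply Nat.mul_divide_cancel_l in H3; [easy|lia].
      - apply Rplus_le_compat_l, Rmult_le_compat_l; [lra|].
        apply divisor_sum_mono. apply Nat.Div0.div_le_upper_bound. nia. }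
    apply (Rmult_le_compat_l (INR p - 1)) in H1; [|lra].
    apply (Rmult_le_compat_l (INR p)) in IH; [|lra].
    rewrite <- (tech_pow_Rmult (INR p) (S a)). lra.
Qed.

Lemma split_prime_power p n :
  is_prime p -> (1 <= n)%nat -> exists a m, n = (p ^ a * m)%nat /\ ~ Nat.divide p m.
Proof.
  intros Hp. pose proof (is_prime_ge2 p Hp). induction n as [n IH] using lt_wf_ind.
  intros Hn. destruct (classic (Nat.divide p n)) as [[k ->]|Hd].
  - destruct (IH k ltac:(nia) ltac:(nia)) as [a [m [-> Hm]]].
    exists (S a), m. split; [|easy]. rewrite Nat.pow_succ_r'. ring.
  - exists O, n. split; [|easy]. simpl. lia.
Qed.

(* Logarithm of the local factor 1 + 1/p + ... + 1/p^(t-1) *)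
Definition local_log (t p : nat) : R := prime_log p + ln (1 - / INR p ^ t).

Lemma inv_pow_bounds t p : is_prime p -> (1 <= t)%nat -> 0 < / INR p ^ t <= / INR p.
Proof.
  intros Hp Ht. pose proof (prime_INR_ge2 p Hp). split.
  - apply Rinv_0_lt_compat, pow_lt. lra.
  - apply Rinv_le_contravar; [lra|]. rewrite <- (pow_1 (INR p)) at 1.
    apply Rle_pow; [lra|easy].
Qed.

Lemma local_log_ge0 t p : is_prime p -> (1 <= t)%nat -> 0 <= local_log t p.
Proof.
  intros Hp Ht. pose proof (inv_pow_bounds t p Hp Ht). pose proof (inv_prime_bounds p Hp).
  unfold local_log, prime_log.
  pose proof (ln_le (1 - / INR p) (1 - / INR p ^ t) ltac:(lra) ltac:(lra)). lra.
Qed.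

Lemma local_log_le t p : is_prime p -> (1 <= t)%nat -> local_log t p <= prime_log p.
Proof.
  intros Hp Ht. pose proof (inv_pow_bounds t p Hp Ht). pose proof (inv_prime_bounds p Hp).
  unfold local_log. pose proof (ln_le_sub1 (1 - / INR p ^ t) ltac:(lra)). lra.
Qed.

Lemma exp_local_log t p : is_prime p -> (1 <= t)%nat ->
  (INR p - 1) * exp (local_log t p) = INR p * (1 - / INR p ^ t).
Proof.
  intros Hp Ht. pose proof (inv_pow_bounds t p Hp Ht). pose proof (inv_prime_bounds p Hp).
  pose proof (prime_INR_ge2 p Hp).
  unfold local_log, prime_log. rewrite exp_plus, exp_Ropp, !exp_ln by lra.
  assert (INR p ^ t <> 0) by (apply pow_nonzero; lra). field. repeat split; lra.
Qed.

(** Induction on a bound for the prime factors, removing the whole power [p^a] of [p = S x].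
    Freeness gives [a + 1 <= t], so the local factor [(p - p^(-a)) / (p - 1)] is at most
    [exp (local_log t p)]. *)
Lemma divisor_sum_le t N x m :
  (1 <= t)%nat -> (1 <= m)%nat -> t_free t m ->
  (forall p, is_prime p -> Nat.divide p m -> (p <= x)%nat) ->
  divisor_sum N m
    <= INR m * exp (psum (fun p => if dvdb p m then local_log t p else 0) x).
Proof.
  intros Ht. revert m. induction x as [|x IH]; intros m Hm Hfree Hx.
  - assert (m = 1)%nat as ->.
    { destruct (Nat.eq_dec m 1) as [|Hm1]; [easy|exfalso].
      destruct (exists_prime_divisor m ltac:(lia)) as [p [Hp Hd]].
      specialize (Hx p Hp Hd). apply is_prime_ge2 in Hp. lia. }
    unfold psum. cbn [nsum]. rewrite exp_0. simpl INR. pose proof (divisor_sum_one N). lra.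
  - rewrite psum_step. destruct (primeb (S x) && dvdb (S x) m)%bool eqn:E.
    + apply andb_prop in E as [E1 E2]. rewrite E1, E2.
      apply primeb_true in E1 as Hp. apply dvdb_true in E2.
      destruct (split_prime_power (S x) m Hp Hm) as [a [k [-> Hk]]].
      set (p := S x) in *. pose proof (prime_INR_ge2 p Hp).
      pose proof (is_prime_ge2 p Hp).
      assert (Hpa : (1 <= p ^ a)%nat)
        by (assert (p ^ a <> 0)%nat by (apply Nat.pow_nonzero; lia); lia).
      assert (Hk1 : (1 <= k)%nat) by nia.
      assert (Hat : (S a <= t)%nat).
      { destruct (le_lt_dec (S a) t) as [|Hlt]; [easy|exfalso].
        apply (Hfree p Hp). exists (p ^ (a - t) * k)%nat.
        replace a with (a - t + t)%nat at 1 by lia. rewrite Nat.pow_add_r. ring. }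
      assert (IHk : divisor_sum N k
        <= INR k * exp (psum (fun q => if dvdb q k then local_log t q else 0) x)).
      { apply IH; [easy| |].
        - intros q Hq Hd. apply (Hfree q Hq). now apply Nat.divide_mul_r.
        - intros q Hq Hd. specialize (Hx q Hq ltac:(now apply Nat.divide_mul_r)).
          enough (q <> p) by (unfold p in *; lia). now intros ->. }
      replace (psum (fun q => if dvdb q (p ^ a * k) then local_log t q else 0) x)
        with (psum (fun q => if dvdb q k then local_log t q else 0) x).
      2:{ apply psum_ext. intros q Hq Hqx. destruct (dvdb q k) eqn:Eq.
          - apply dvdb_true in Eq.
            rewrite (proj2 (dvdb_true _ _)); [easy|]. now apply Nat.divide_mul_r.
          - apply dvdb_false in Eq. rewrite (proj2 (dvdb_false _ _)); [easy|].
            intros Hd. apply Eq. apply divides_prime_power_coprime in Hd; [easy|easy|].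
            intros Hd'. apply (prime_divides_prime p q Hp Hq) in Hd'. unfold p in *. lia. }
      set (e := psum _ x) in *. rewrite exp_plus, mult_INR, pow_INR.
      pose proof (divisor_sum_prime_power N p a k Hp Hk) as H3.
      pose proof (exp_local_log t p Hp Ht) as H4.
      apply Rmult_le_reg_l with (INR p - 1); [lra|].
      apply Rle_trans with (1 := H3).
      apply Rle_trans with ((INR p ^ S a - 1) * (INR k * exp e)).
      { apply Rmult_le_compat_l; [|easy].
        assert (1 <= INR p ^ S a) by (apply pow_R1_Rle; lra). lra. }
      replace ((INR p - 1) * (INR p ^ a * INR k * (exp e * exp (local_log t p))))
        with (INR p ^ a * ((INR p - 1) * exp (local_log t p)) * (INR k * exp e)) by ring.
      apply Rmult_le_compat_r.
      { apply Rmult_le_pos; [apply pos_INR|left; apply exp_pos]. }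
      rewrite H4. rewrite <- (tech_pow_Rmult (INR p) a).
      assert (Hpow : INR p ^ S a * / INR p ^ t <= 1).
      { assert (0 < INR p ^ t) by (apply pow_lt; lra).
        apply Rmult_le_reg_r with (INR p ^ t); [easy|].
        rewrite Rmult_assoc, Rinv_l by lra. rewrite Rmult_1_r, Rmult_1_l.
        apply Rle_pow; [lra|easy]. }
      rewrite <- tech_pow_Rmult in Hpow. lra.
    + replace (if primeb (S x) then _ else 0) with 0
        by (destruct (primeb (S x)), (dvdb (S x) m); easy).
      rewrite Rplus_0_r. apply IH; [easy|easy|].
      intros p Hp Hd. specialize (Hx p Hp Hd).
      enough (p <> S x) by lia. intros ->.
      rewrite (proj2 (primeb_true _) Hp), (proj2 (dvdb_true _ _) Hd) in E. easy.
Qed.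

Lemma ln_radical_le m : (1 <= m)%nat ->
  psum (fun p => if dvdb p m then ln (INR p) else 0) m <= ln (INR m).
Proof.
  intros Hm. rewrite (ln_prime_factorization m m) by lia. apply psum_le.
  intros p Hp _. pose proof (prime_INR_ge2 p Hp).
  assert (0 <= ln (INR p)) by (apply ln_ge0; lra).
  destruct (dvdb p m) eqn:E.
  - apply dvdb_true in E as [k ->]. pose proof (is_prime_ge2 p Hp).
    rewrite Nat.mul_comm, val_mul_self, S_INR by nia.
    pose proof (pos_INR (val p k)). nra.
  - apply Rmult_le_pos; [apply pos_INR|easy].
Qed.

Lemma is_prime_2 : is_prime 2.
Proof.
  split; [lia|]. intros d Hd.
  assert (d <= 2)%nat by (apply Nat.divide_pos_le; [lia|easy]).
  assert (d <> 0)%nat by (intros ->; apply Nat.divide_0_l in Hd; lia). lia.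
Qed.

(* Primes up to [X] contribute at most the Euler product, where [p = 2] keeps its factor
   [1 - 2^-t]; each prime divisor beyond [X] contributes at most [2 / X]. *)
Lemma local_log_sum_le t X s :
  (1 <= t)%nat -> (2 <= X <= s)%nat ->
  psum (fun p => if dvdb p s then local_log t p else 0) s
    <= euler_log X - / 2 ^ t + 2 / (INR X * ln (INR X)) * ln (INR s).
Proof.
  intros Ht [HX HXs]. pose proof (INR_ge2 X HX) as HX2.
  assert (HlX : 0 < ln (INR X)) by (apply ln_gt0; lra).
  set (c := 2 / (INR X * ln (INR X))).
  assert (Hc : 0 < c) by (apply Rdiv_lt_0_compat; nra).
  apply Rle_trans with (psum (fun p => (if (p <=? X)%nat then prime_log p else 0) +
     (if (p =? 2)%nat then ln (1 - / INR p ^ t) else 0) +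
     c * (if dvdb p s then ln (INR p) else 0)) s).
  - apply psum_le. intros p Hp Hps. pose proof (prime_INR_ge2 p Hp) as Hp2.
    assert (0 <= ln (INR p)) by (apply ln_ge0; lra).
    pose proof (local_log_ge0 t p Hp Ht). pose proof (local_log_le t p Hp Ht).
    assert (0 <= c * (if dvdb p s then ln (INR p) else 0))
      by (apply Rmult_le_pos; [|destruct (dvdb p s)]; lra).
    destruct (Nat.leb_spec p X) as [HpX|HpX].
    + destruct (Nat.eqb_spec p 2) as [->|].
      * unfold local_log in *. destruct (dvdb 2 s); lra.
      * destruct (dvdb p s); lra.
    + rewrite (proj2 (Nat.eqb_neq p 2)) by lia.
      destruct (dvdb p s); [|lra].
      pose proof (prime_log_le p Hp).
      apply lt_INR in HpX.
      assert (2 / INR p <= 2 / INR X).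
      { apply Rmult_le_compat_l; [lra|]. apply Rinv_le_contravar; lra. }
      assert (2 / INR X = c * ln (INR X)) by (unfold c; field; lra).
      assert (ln (INR X) <= ln (INR p)) by (apply ln_le; lra).
      nra.
  - rewrite !psum_plus, psum_scal, psum_truncate by easy.
    rewrite (psum_delta (fun p => ln (1 - / INR p ^ t))) by (apply is_prime_2 || lia).
    pose proof (ln_radical_le s ltac:(lia)) as H1.
    apply (Rmult_le_compat_l c) in H1; [|lra].
    pose proof (inv_pow_bounds t 2 is_prime_2 Ht).
    pose proof (inv_prime_bounds 2 is_prime_2).
    pose proof (ln_le_sub1 (1 - / INR 2 ^ t) ltac:(lra)) as H3.
    replace (INR 2) with 2 in * by (simpl; ring).
    unfold euler_log. lra.
Qed.

(** * Primorials *)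

Lemma divide_fact d n : (1 <= d <= n)%nat -> Nat.divide d (fact n).
Proof.
  induction n as [|n IH]; intros Hd; [lia|]. change (fact (S n)) with (S n * fact n)%nat.
  destruct (Nat.eq_dec d (S n)) as [->|]; [apply Nat.divide_factor_l|].
  apply Nat.divide_mul_r, IH. lia.
Qed.

Lemma exists_prime_gt n : exists p, is_prime p /\ (n < p)%nat.
Proof.
  pose proof (lt_O_fact n).
  destruct (exists_prime_divisor (fact n + 1) ltac:(lia)) as [p [Hp Hd]].
  exists p. split; [easy|]. pose proof (is_prime_ge2 p Hp).
  destruct (le_lt_dec p n) as [Hle|]; [exfalso|easy].
  apply Nat.divide_add_cancel_r in Hd; [|apply divide_fact; lia].
  apply Nat.divide_1_r in Hd. lia.
Qed.

(** The specification of the epsilon is satisfiable: descend from Euclid's prime to the least one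
    above [n]. *)
Lemma next_prime_is_prime n : is_prime (next_prime n).
Proof.
  enough (H : exists q, is_prime q /\ (n < q)%nat /\
            forall r, (n < r < q)%nat -> ~ is_prime r)
    by apply (epsilon_spec (inhabits 0%nat) _ H).
  destruct (exists_prime_gt n) as [p Hp].
  induction p as [p IH] using lt_wf_ind.
  destruct (classic (exists r, (n < r < p)%nat /\ is_prime r)) as [[r [Hr Hrp]]|Hno].
  - apply (IH r); [lia|]. split; [easy|lia].
  - exists p. split; [easy|]. split; [easy|].
    intros r Hr Hrp. apply Hno. now exists r.
Qed.

Lemma prime_seq_is_prime i : is_prime (prime_seq i).
Proof. destruct i; [exact is_prime_2|apply next_prime_is_prime]. Qed.

Lemma pow2_le_primorial n : (2 ^ n <= primorial n)%nat.
Proof.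
  induction n as [|n IH]; [easy|]. cbn [primorial]. rewrite Nat.pow_succ_r'.
  pose proof (is_prime_ge2 _ (prime_seq_is_prime n)). nia.
Qed.

(** * Assembly of the estimates *)

Lemma exists_floor y : 0 <= y -> exists X, INR X <= y < INR X + 1.
Proof.
  intros Hy. destruct (INR_unbounded y) as [n Hn].
  induction n as [|n IH]; [simpl in Hn; lra|].
  rewrite S_INR in Hn. destruct (Rle_lt_dec (INR n) y) as [Hle|Hlt].
  - exists n. lra.
  - apply IH. lra.
Qed.

(** The 14 is the 10 of [euler_log_le] plus 4 for the primes beyond [X], where
    [ln s < X + 1 <= 2 X]. The saving [2^(-t)] at the prime 2 beats [14 / ln X]. *)
Lemma sigma_div_lt t s X :
  (1 <= t)%nat -> (1 <= s)%nat -> t_free t s -> (2 <= X)%nat ->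
  INR X <= ln (INR s) < INR X + 1 -> 14 * 2 ^ t < ln (INR X) ->
  INR (sigma_div s) < exp euler_gamma * INR s * ln (ln (INR s)).
Proof.
  intros Ht Hs Hfree HX [HX1 HX2] Hsmall. pose proof (INR_ge2 X HX).
  assert (Hs1 : 1 <= INR s) by now apply INR_ge1.
  assert (HXs : (X <= s)%nat).
  { apply INR_le. pose proof (ln_le_sub1 (INR s) ltac:(lra)). lra. }
  assert (HlX : 0 < ln (INR X)) by (apply ln_gt0; lra).
  rewrite sigma_div_divisor_sum.
  apply Rle_lt_trans with (INR s *
    exp (psum (fun p => if dvdb p s then local_log t p else 0) s)).
  { apply divisor_sum_le; [easy|easy|easy|].
    intros p _ Hd. apply Nat.divide_pos_le; [lia|easy]. }
  apply Rlt_le_trans with (INR s * exp (euler_gamma + ln (ln (INR X)))).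
  - apply Rmult_lt_compat_l; [lra|]. apply exp_increasing.
    pose proof (local_log_sum_le t X s Ht (conj HX HXs)) as H1.
    pose proof (euler_log_le X HX) as H2.
    assert (H3 : 2 / (INR X * ln (INR X)) * ln (INR s) <= 4 / ln (INR X)).
    { replace (4 / ln (INR X)) with (2 / (INR X * ln (INR X)) * (2 * INR X))
        by (field; lra).
      apply Rmult_le_compat_l; [|lra].
      left. apply Rdiv_lt_0_compat; [lra|]. apply Rmult_lt_0_compat; lra. }
    assert (H2t : 0 < 2 ^ t) by (apply pow_lt; lra).
    assert (H4 : 14 / ln (INR X) < / 2 ^ t).
    { apply Rmult_lt_reg_r with (ln (INR X) * 2 ^ t); [now apply Rmult_lt_0_compat|].
      replace (14 / ln (INR X) * (ln (INR X) * 2 ^ t)) with (14 * 2 ^ t) by (field; lra).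
      replace (/ 2 ^ t * (ln (INR X) * 2 ^ t)) with (ln (INR X)) by (field; lra). easy. }
    unfold Rdiv in *. lra.
  - rewrite exp_plus, exp_ln by easy.
    replace (exp euler_gamma * INR s * ln (ln (INR s)))
      with (INR s * (exp euler_gamma * ln (ln (INR s)))) by ring.
    apply Rmult_le_compat_l; [lra|]. apply Rmult_le_compat_l; [left; apply exp_pos|].
    apply ln_le; lra.
Qed.

Lemma half_le_ln2 : / 2 <= ln 2.
Proof.
  pose proof (ln_S_sub 1 ltac:(lia)) as [H _]. simpl INR in H.
  rewrite ln_1 in H. replace (1 + 1) with 2 in H by ring. lra.
Qed.

(* With [u = ln n]: if [t <= ln u / 2] then [2^t <= sqrt u], which is beaten by
   [ln X >= u / 2]. *)
Lemma pow2_lt_ln t n X :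
  785 <= ln (INR n) -> 1 <= INR n -> INR t <= / 2 * ln (ln (INR n)) ->
  INR n / 2 - 1 <= INR X -> 14 * 2 ^ t < ln (INR X).
Proof.
  intros Hu Hn Ht HX. set (u := ln (INR n)) in *.
  assert (E : INR n = exp (u / 2) * exp (u / 2)).
  { rewrite <- exp_plus. replace (u / 2 + u / 2) with u by lra.
    symmetry. apply exp_ln. lra. }
  pose proof (exp_ineq1_le (u / 2)).
  assert (HlX : u / 2 <= ln (INR X)).
  { rewrite <- (ln_exp (u / 2)). apply ln_le; [apply exp_pos|]. nra. }
  set (w := exp (/ 2 * ln u)).
  assert (Ew : w * w = u).
  { unfold w. rewrite <- exp_plus.
    replace (/ 2 * ln u + / 2 * ln u) with (ln u) by lra. apply exp_ln. lra. }
  assert (0 < w) by apply exp_pos.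
  assert (H2t : 2 ^ t <= w).
  { rewrite <- (Rpower_pow t 2) by lra. unfold Rpower, w. apply exp_le.
    pose proof (ln_le_sub1 2 ltac:(lra)). pose proof half_le_ln2.
    pose proof (pos_INR t). nra. }
  (* Since [785 > 28^2], [w > 28] and so [14 * 2^t <= 14 * w < w * w / 2 = u / 2]. *)
  assert (28 < w) by nra. nra.
Qed.

Theorem mainTheorem12 (t Sn : nat -> nat) :
  (forall n, (2 <= t n)%nat) ->
  Un_cv (fun n => INR (t n) / ln (ln (INR n))) 0 ->
  (forall n, (0 < Sn n)%nat) ->
  (exists n0, forall n, (n0 <= n)%nat ->
      (primorial n <= Sn n)%nat /\ t_free (t n) (Sn n)) ->
  exists n1, forall n, (n1 <= n)%nat ->
    INR (sigma_div (Sn n)) < exp euler_gamma * INR (Sn n) * ln (ln (INR (Sn n))).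
Proof.
  intros Ht Hlim Hpos [n0 Hn0].
  destruct (Hlim (/ 2) ltac:(lra)) as [N1 HN1].
  destruct (INR_unbounded (exp 785)) as [N2 HN2].
  exists (Nat.max n0 (Nat.max N1 N2)). intros n Hn.
  destruct (Hn0 n ltac:(lia)) as [HS Hfree]. specialize (HN1 n ltac:(lia)).
  assert (HnN : INR N2 <= INR n) by (apply le_INR; lia).
  pose proof (exp_ineq1_le 785).
  assert (Hu : 785 <= ln (INR n)).
  { rewrite <- (ln_exp 785). apply ln_le; [apply exp_pos|lra]. }
  assert (Hlu : 0 < ln (ln (INR n))) by (apply ln_gt0; lra).
  assert (Htn : INR (t n) <= / 2 * ln (ln (INR n))).
  { unfold Rdist in HN1. rewrite Rminus_0_r in HN1. apply Rabs_def2 in HN1 as [H1 _].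
    apply (Rmult_lt_compat_r (ln (ln (INR n)))) in H1; [|easy].
    unfold Rdiv in H1. rewrite Rmult_assoc, Rinv_l in H1 by lra. lra. }
  (* From [2^n <= primorial n <= Sn n] and [ln 2 >= 1 / 2]. *)
  assert (HlnS : INR n / 2 <= ln (INR (Sn n))).
  { pose proof (pow2_le_primorial n).
    assert (Hle : INR (2 ^ n) <= INR (Sn n)) by (apply le_INR; lia).
    rewrite pow_INR in Hle. replace (INR 2) with 2 in Hle by (simpl; ring).
    apply ln_le in Hle; [|apply pow_lt; lra]. rewrite ln_pow in Hle by lra.
    pose proof half_le_ln2. nra. }
  destruct (exists_floor (ln (INR (Sn n))) ltac:(lra)) as [X HX].
  apply (sigma_div_lt (t n) (Sn n) X); [|apply Hpos|easy| |easy|].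
  - specialize (Ht n). lia.
  - apply INR_le. simpl. lra.
  - apply pow2_lt_ln with n; lra.
Qed.
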